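(* Let $\mathbf{k}$ be a field, let $X=\{x_1,\ldots,x_n\}$ and $Y=\{y_1,\ldots,y_m\}$ be disjoint finite sets of variables, and let $S=\mathbf{k}[x_1,\ldots,x_n,y_1,\ldots,y_m]$. Let $G$ be a bipartite graph on the vertex set $X\sqcup Y$, all of whose edges are of the form $\{x_i,y_j\}$, and let $I=(x_iy_j : \{x_i,y_j\}\in E(G))\subset S$ be its edge ideal. Let $H$ be the bipartite graph on $X\sqcup Y$ with edge set $$E(H)=\{\{x_i,y_j\} : 1\le i\le n,\ 1\le j\le \deg_G x_i\},$$ where $\deg_G x_i$ is the number of neighbors of $x_i$ in $G$, and let $J=(x_iy_j:\{x_i,y_j\}\in E(H))\subset S$ be its edge ideal. Then for all $X'\subseteq X$ and all integers $i\ge 0$, $$\beta_{i,X',\bullet}(I)\ \ge\ \beta_{i,X',\bullet}(J).$$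
   Context: Give $S$ the fine $\mathbb{Z}^{n+m}$-grading with $\deg x_i=e_i$ and $\deg y_j=e_{n+j}$. For a squarefree monomial ideal $K\subset S$ and $W\subseteq X\sqcup Y$, $\beta_{i,W}(K)$ denotes the multigraded Betti number of $K$ (viewed as an $S$-module, so that $i=0$ corresponds to minimal generators of $K$) in homological degree $i$ and multidegree $\sum_{v\in W}\deg v$; that is, $\beta_{i,W}(K)=\dim_{\mathbf{k}}\operatorname{Tor}_i^S(K,\mathbf{k})_{\sum_{v\in W}\deg v}$. For $X'\subseteq X$, $\beta_{i,X',\bullet}(K)$ denotes the Betti number of $K$ for the coarser $\mathbb{Z}^n$-grading in which $\deg x_i=e_i$ and $\deg y_j=0$, in homological degree $i$ and degree $\sum_{x_k\in X'}e_k$; it is given by $$\beta_{i,X',\bullet}(K)=\sum_{Y'\subseteq Y}\beta_{i,X'\sqcup Y'}(K).$$ *)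

(* Defs.v *)
From HB Require Import structures.
From mathcomp Require Import all_boot all_order all_algebra.
From mathcomp Require Import mpoly.
From Stdlib Require Import ClassicalEpsilon.

Set Implicit Arguments.
Unset Strict Implicit.
Unset Printing Implicit Defensive.

Import GRing.Theory.
Local Open Scope ring_scope.

(** A grading of [S = k[z_0, ..., z_(N-1)]] by an abelian group [A] is given by
    the degrees [w v] of the variables. *)

Definition wdeg (A : zmodType) (N : nat) (w : 'I_N -> A) (mon : 'X_{1..N}) : A :=
  \sum_(v < N) w v *+ mon v.

(** The zero polynomial is homogeneous of every degree. *)
Definition homogeneous (k : fieldType) (A : zmodType) (N : nat)
    (w : 'I_N -> A) (a : A) (p : {mpoly k[N]}) : Prop :=
  forall mon, mon \in msupp p -> wdeg w mon = a.

(** An [A]-graded resolution [... -> F_1 -> F_0 -> K -> 0] of an ideal [K] by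
    free [S]-modules of finite rank. Elements of [F_i] are row vectors
    over [S], maps act by right multiplication, and all maps have degree 0. *)
Record graded_free_resolution (k : fieldType) (A : zmodType) (N : nat)
    (w : 'I_N -> A) (K : {mpoly k[N]} -> Prop) := GradedFreeResolution {
  frank : nat -> nat;
  bdeg : forall i, 'I_(frank i) -> A;
  aug : 'cV[{mpoly k[N]}]_(frank 0);
  fdiff : forall i, 'M[{mpoly k[N]}]_(frank i.+1, frank i);
  aug_homogeneous : forall b, homogeneous w (bdeg b) (aug b 0);
  fdiff_homogeneous : forall i (b : 'I_(frank i.+1)) (b' : 'I_(frank i)),
    homogeneous w (bdeg b - bdeg b') (fdiff i b b');
  aug_image : forall p : {mpoly k[N]},
    K p <-> exists u : 'rV_(frank 0), p = (u *m aug) 0 0;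
  aug_exact : forall u : 'rV_(frank 0),
    u *m aug = 0 <-> exists v : 'rV_(frank 1), u = v *m fdiff 0;
  fdiff_exact : forall i (u : 'rV_(frank i.+1)),
    u *m fdiff i = 0 <-> exists v : 'rV_(frank i.+2), u = v *m fdiff i.+1
}.

Section Tor.
Variables (k : fieldType) (A : zmodType) (N : nat) (w : 'I_N -> A).
Variables (K : {mpoly k[N]} -> Prop) (F : graded_free_resolution w K).

(** [F_i (x)_S k] is the space of row vectors over [k] of length [frank F i];
    since [k = S/(z_0, ..., z_(N-1))], its differential is given by the constant
    terms of the entries. *)
Definition tensor_diff (i : nat) : 'M[k]_(frank F i.+1, frank F i) :=
  map_mx (mcoeff 0%MM) (fdiff F i).

(** Its degree [a] part, as a row space: the span of the basis vectors of
    degree [a]. *)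
Definition tensor_part (i : nat) (a : A) : 'M[k]_(frank F i) :=
  diag_mx (\row_b (bdeg b == a)%:R).

Definition tor_cycles (i : nat) (a : A) : 'M[k]_(frank F i) :=
  match i return 'M[k]_(frank F i) with
  | 0 => tensor_part 0 a
  | j.+1 => (tensor_part j.+1 a :&: kermx (tensor_diff j))%MS
  end.

Definition tor_boundaries (i : nat) (a : A) : 'M[k]_(frank F i.+1, frank F i) :=
  tensor_part i.+1 a *m tensor_diff i.

(** The dimension of [H_i (F (x)_S k)] in degree [a]. The subtraction is not
    truncated, because boundaries are cycles. *)
Definition tor_dim (i : nat) (a : A) : nat :=
  (\rank (tor_cycles i a) - \rank (tor_boundaries i a))%N.

End Tor.

(** [dim_k Tor_i^S(K, k)_a]. Every homogeneous ideal [K] has a resolution as above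
    ([S] is noetherian), and the dimension does not depend on the resolution. *)
Definition betti (k : fieldType) (A : zmodType) (N : nat) (w : 'I_N -> A)
    (K : {mpoly k[N]} -> Prop) (i : nat) (a : A) : nat :=
  epsilon (inhabits 0%N)
    (fun d => exists F : graded_free_resolution w K, tor_dim F i a = d).

(** Among the [n + m] variables, [x_i] is number [lshift m i] and [y_j] is number
    [rshift n j]. *)
Definition xvar (k : fieldType) (n m : nat) (i : 'I_n) : {mpoly k[n + m]} :=
  'X_(lshift m i).

Definition yvar (k : fieldType) (n m : nat) (j : 'I_m) : {mpoly k[n + m]} :=
  'X_(rshift n j).

Definition unit_deg (n : nat) (i : 'I_n) : {ffun 'I_n -> int} :=
  [ffun l => (l == i)%:R].

Definition xgrading (n m : nat) (v : 'I_(n + m)) : {ffun 'I_n -> int} :=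
  match split v with
  | inl i => unit_deg i
  | inr _ => 0
  end.

(** [beta_(i, X', bullet)]. *)
Definition xbetti (k : fieldType) (n m : nat) (K : {mpoly k[n + m]} -> Prop)
    (i : nat) (X' : {set 'I_n}) : nat :=
  betti (@xgrading n m) K i (\sum_(l in X') unit_deg l).

(** A bipartite graph all of whose edges join some [x_i] to some [y_j] is the set
    of the pairs [(i, j)] such that [{x_i, y_j}] is an edge. *)
Definition bigraph (n m : nat) := {set 'I_n * 'I_m}.

Definition xdegree (n m : nat) (G : bigraph n m) (i : 'I_n) : nat :=
  #|[set j | (i, j) \in G]|.

(** Indices start at 0 here, so [1 <= j <= deg x_i] becomes [j < deg x_i]. *)
Definition degree_graph (n m : nat) (G : bigraph n m) : bigraph n m :=
  [set e : 'I_n * 'I_m | (e.2 < xdegree G e.1)%N].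

Definition edge_ideal (k : fieldType) (n m : nat) (G : bigraph n m)
    (p : {mpoly k[n + m]}) : Prop :=
  exists c : 'I_n * 'I_m -> {mpoly k[n + m]},
    p = \sum_(e in G) c e * (xvar k m e.1 * yvar k n e.2).

(* Main.v *)
Require Import Defs.
From mathcomp Require Import all_boot all_order all_algebra.
From mathcomp Require Import mpoly.
From HB Require Import structures.
From mathcomp Require Import fraction.
From Stdlib Require Import ClassicalEpsilon.

Set Implicit Arguments.
Unset Strict Implicit.
Unset Printing Implicit Defensive.

Import GRing.Theory.
Local Open Scope ring_scope.

(** Let [x_0] have the least degree among the vertices of [X'], and let [Y0] be its
    neighbourhood. The ideal [J] has linear quotients, and the iterated mapping
    cone bounds its Betti number in degree [X'] by [C(#|Y0|, i + 2 - #|X'|)].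

    For [I], set the [x_r] outside [X'] to zero and make the [y_j] outside [Y0]
    invertible. As no [x_r] in [X'] has fewer neighbours than [x_0], the ideal
    then becomes that of a graph with nested neighbourhoods in which [x_0] has
    neighbourhood [Y0]; it has linear quotients as well, and its resolution [L]
    has exactly [C(#|Y0|, i + 2 - #|X'|)] basis elements in degree [X'], between
    which the differential vanishes at the point [x = 0], [y_j = 0] for [j] in
    [Y0]. Concretely, with [u] the product of the [y_j] outside [Y0], there are
    chain maps between [L] and any resolution of [I] whose composition is
    homotopic to [u], so that at a point where [u] is invertible the homology of
    [L] is a direct summand. Letting the [y_j] outside [Y0] tend to [0] can only
    enlarge the homology, whence the bound for [Tor(I, k)]. *)

(** * Homogeneous polynomials and matrices *)

(** Chain maps and homotopies are built degree by degree from existence statements: [Inv] records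
    what makes the next step solvable, [R] ties consecutive terms together. *)
Lemma dependent_choice (T : nat -> Type) (Q : T 0%N -> Prop)
    (Inv : forall i, T i -> Prop) (R : forall i, T i -> T i.+1 -> Prop) :
  (exists2 x, Inv 0%N x & Q x) ->
  (forall i x, Inv i x -> exists2 y, Inv i.+1 y & R i x y) ->
  exists f : forall i, T i,
    [/\ Q (f 0%N), forall i, Inv i (f i) & forall i, R i (f i) (f i.+1)].
Proof.
move=> [x0 Ix0 Qx0] exS.
pose X i := {x : T i | Inv i x}.
have next i (x : X i) : {y : X i.+1 | R i (sval x) (sval y)}.
  apply: constructive_indefinite_description.
  by have [y Iy Ry] := exS i _ (svalP x); exists (exist _ y Iy).
pose f := fix f i : X i :=
  if i is j.+1 return X i then sval (next j (f j)) else exist _ x0 Ix0.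
exists (fun i => sval (f i)); split=> // i; first exact: svalP.
exact: svalP (next i (f i)).
Qed.

Section Homogeneous.
Variables (k : fieldType) (A : zmodType) (N : nat) (w : 'I_N -> A).
Implicit Types (p q : {mpoly k[N]}) (a b : A).

Lemma wdeg0 : wdeg w 0%MM = 0.
Proof. by rewrite /wdeg big1 // => v _; rewrite mnm0E mulr0n. Qed.

Lemma wdegD m1 m2 : wdeg w (m1 + m2)%MM = wdeg w m1 + wdeg w m2.
Proof.
by rewrite /wdeg -big_split; apply: eq_bigr => v _; rewrite mnmDE mulrnDr.
Qed.

Lemma homogeneous_mcoeffP a p :
  homogeneous w a p <-> (forall mon, wdeg w mon != a -> p@_mon = 0).
Proof.
split=> [hp mon ne | hp mon].
  by apply: memN_msupp_eq0; apply: contra ne => /hp ->.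
by rewrite mcoeff_msupp => ne; apply/eqP; apply: contraR ne => /hp ->.
Qed.

Lemma homogeneous0 a : homogeneous w a (0 : {mpoly k[N]}).
Proof. by move=> mon; rewrite msupp0. Qed.

Lemma homogeneousD a p q :
  homogeneous w a p -> homogeneous w a q -> homogeneous w a (p + q).
Proof.
move=> hp hq mon /msuppD_le; rewrite mem_cat => /orP[/hp | /hq] //.
Qed.

Lemma homogeneousN a p : homogeneous w a p -> homogeneous w a (- p).
Proof. by move=> hp mon; rewrite (perm_mem (msuppN p)) => /hp. Qed.

Lemma homogeneousB a p q :
  homogeneous w a p -> homogeneous w a q -> homogeneous w a (p - q).
Proof. by move=> hp hq; apply/homogeneousD/homogeneousN. Qed.

Lemma homogeneousM a b p q :
  homogeneous w a p -> homogeneous w b q -> homogeneous w (a + b) (p * q).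
Proof.
move=> hp hq mon /msuppM_le /allpairsP[[m1 m2] /= [/hp <- /hq <- ->]].
exact: wdegD.
Qed.

Lemma homogeneous_sum a (I : Type) (r : seq I) (P : pred I)
    (F : I -> {mpoly k[N]}) :
  (forall i, P i -> homogeneous w a (F i)) ->
  homogeneous w a (\sum_(i <- r | P i) F i).
Proof. by move=> hF; elim/big_ind: _ => //; [exact: homogeneous0 | exact: homogeneousD]. Qed.

Lemma homogeneousX mon : homogeneous w (wdeg w mon) ('X_[mon] : {mpoly k[N]}).
Proof. by move=> m'; rewrite msuppX inE => /eqP ->. Qed.

Lemma homogeneous1 : homogeneous w 0 (1 : {mpoly k[N]}).
Proof. by rewrite -wdeg0 -mpolyX0; exact: homogeneousX. Qed.

Definition hpart a p : {mpoly k[N]} :=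
  \sum_(mon <- msupp p | wdeg w mon == a) p@_mon *: 'X_[mon].

Lemma mcoeff_hpart a p mon :
  (hpart a p)@_mon = if wdeg w mon == a then p@_mon else 0.
Proof.
rewrite /hpart raddf_sum /= big_mkcond /=.
under eq_bigr => m' _ do rewrite mcoeffZ mcoeffX.
have [msp | msp] := boolP (mon \in msupp p); last first.
  rewrite (memN_msupp_eq0 msp) if_same big1_seq // => m' /andP[_ m'p].
  case: (eqVneq m' mon) => [e | _]; first by rewrite -e m'p in msp.
  by rewrite mulr0 if_same.
rewrite (bigD1_seq mon) ?msupp_uniq //= eqxx mulr1 big1 ?addr0 // => m' ne.
by rewrite (negPf ne) mulr0 if_same.
Qed.

Lemma homogeneous_hpart a p : homogeneous w a (hpart a p).
Proof.
by apply/homogeneous_mcoeffP => mon ne; rewrite mcoeff_hpart (negPf ne).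
Qed.

Lemma hpartD a p q : hpart a (p + q) = hpart a p + hpart a q.
Proof.
apply/mpolyP => mon; rewrite mcoeffD !mcoeff_hpart mcoeffD.
by case: ifP => // _; rewrite addr0.
Qed.

Lemma hpart0 a : hpart a 0 = 0.
Proof. by rewrite /hpart msupp0 big_nil. Qed.

Lemma hpart_id a p : homogeneous w a p -> hpart a p = p.
Proof.
move=> /homogeneous_mcoeffP hp; apply/mpolyP => mon; rewrite mcoeff_hpart.
by case: eqVneq => // /hp.
Qed.

(** A factor [q] of degree [b] shifts degrees by [b], so the components of [p] of degree other than
    [a] contribute nothing in degree [a + b]. *)
Lemma hpartM a b p q :
  homogeneous w b q -> hpart a p * q = hpart (a + b) (p * q).
Proof.
move=> hq; have -> : p * q = hpart a p * q + (p - hpart a p) * q.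
  by rewrite -mulrDl addrC subrK.
rewrite hpartD [X in _ = X + _]hpart_id; last exact: homogeneousM (@homogeneous_hpart a p) hq.
rewrite [X in _ + X](_ : _ = 0) ?addr0 //.
apply/mpolyP => mon; rewrite mcoeff_hpart mcoeff0; case: eqP => // mona.
apply: memN_msupp_eq0; apply/negP => /msuppM_le /allpairsP[[m1 m2] /=].
case=> m1p /hq dm2 e; move: m1p; rewrite mcoeff_msupp mcoeffB mcoeff_hpart.
move: mona; rewrite e wdegD dm2 => /addIr ->.
by rewrite eqxx subrr eqxx.
Qed.

Definition homogeneous_mx (p q : nat) (dp : 'I_p -> A) (dq : 'I_q -> A)
    (M : 'M[{mpoly k[N]}]_(p, q)) :=
  forall i j, homogeneous w (dp i - dq j) (M i j).

Lemma homogeneous_mulmx (p q r : nat) (dp : 'I_p -> A) (dq : 'I_q -> A)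
    (dr : 'I_r -> A) M L :
  homogeneous_mx dp dq M -> homogeneous_mx dq dr L ->
  homogeneous_mx dp dr (M *m L).
Proof.
move=> hM hL b b'; rewrite mxE; apply: homogeneous_sum => c _.
by rewrite -(subrKA (dq c)); apply: homogeneousM.
Qed.

Lemma homogeneous_mxB (p q : nat) (dp : 'I_p -> A) (dq : 'I_q -> A) M L :
  homogeneous_mx dp dq M -> homogeneous_mx dp dq L ->
  homogeneous_mx dp dq (M - L).
Proof. by move=> hM hL b b'; rewrite !mxE; apply: homogeneousB. Qed.

Lemma homogeneous_scalar (p : nat) (dp : 'I_p -> A) u :
  homogeneous w 0 u -> homogeneous_mx dp dp u%:M.
Proof.
move=> hu b b'; rewrite mxE; case: eqP => [-> | _] /=.
  by rewrite subrr mulr1n.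
by rewrite mulr0n; apply: homogeneous0.
Qed.

(** Factor the rows without regard to degrees, then keep from each coefficient the component of the
    required degree; as [M] and [D] are homogeneous, the product is unchanged. *)
Lemma homogeneous_factor (p q r : nat) (dp : 'I_p -> A) (dq : 'I_q -> A)
    (dr : 'I_r -> A) (M : 'M_(p, q)) (D : 'M_(r, q)) :
  homogeneous_mx dp dq M -> homogeneous_mx dr dq D ->
  (forall i, exists v, row i M = v *m D) ->
  exists2 V, homogeneous_mx dp dr V & M = V *m D.
Proof.
move=> hM hD /fin_all_exists[v Mv].
exists (\matrix_(i, j) hpart (dp i - dr j) (v i 0 j)).
  by move=> b c; rewrite mxE; apply: homogeneous_hpart.
apply/matrixP => b b'; rewrite mxE.
have -> : M b b' = \sum_c v b 0 c * D c b'.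
  by move/matrixP: (Mv b) => /(_ 0 b'); rewrite !mxE.
rewrite -[LHS](hpart_id (a := dp b - dq b')); last first.
  have -> : \sum_c v b 0 c * D c b' = M b b'.
    by move/matrixP: (Mv b) => /(_ 0 b'); rewrite !mxE.
  exact: hM.
rewrite (big_morph (hpart _) (@hpartD _) (@hpart0 _)).
by apply: eq_bigr => c _; rewrite mxE (hpartM _ _ (hD c b')) subrKA.
Qed.

End Homogeneous.

(** * Graded complexes, comparison maps, and specialization *)

Lemma rank_diag_pred_le (L : fieldType) n (f : pred 'I_n) :
  (\rank (diag_mx (\row_b (f b)%:R) : 'M[L]_n) <= #|f|)%N.
Proof.
have -> : diag_mx (\row_b (f b)%:R) = \sum_(b in f) delta_mx b b :> 'M[L]_n.
  apply/matrixP => i j; rewrite summxE !mxE.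
  case: eqVneq => [<- | ne].
    under eq_bigr => b _ do rewrite mxE andbb eq_sym.
    rewrite mulr1n big_mkcond (bigD1 i) //= eqxx big1 ?addr0; last first.
      by move=> b /negPf ->; rewrite if_same.
    by rewrite unfold_in; case: (f i).
  rewrite mulr0n big1 // => b _; rewrite mxE.
  by have [<- | //] := eqVneq i b; rewrite eq_sym (negPf ne) andbF.
apply: (@leq_trans (\sum_(b in f) 1)); last by rewrite sum1_card.
elim/big_ind2: _ => [|M1 r1 M2 r2 le1 le2|b _]; first by rewrite mxrank0.
  exact: leq_trans (mxrank_add _ _) (leq_add le1 le2).
by rewrite mxrank_delta.
Qed.

(** The matrices of [f] and of its complement add up to the identity, so both upper bounds are
    attained. *)
Lemma rank_diag_pred (L : fieldType) n (f : pred 'I_n) :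
  \rank (diag_mx (\row_b (f b)%:R) : 'M[L]_n) = #|f|.
Proof.
apply/eqP; rewrite eqn_leq rank_diag_pred_le -(leq_add2r #|predC f|) cardC /=.
apply: leq_trans (leq_add (leqnn _) (rank_diag_pred_le L (predC f))).
apply: leq_trans (mxrank_add _ _); rewrite -raddfD /= card_ord.
rewrite (_ : diag_mx _ = 1%:M) ?mxrank1 //; apply/matrixP => i j; rewrite !mxE.
by rewrite /=; case: (f i); rewrite /= ?addr0 ?add0r.
Qed.

(** The last inclusion makes [be] after [al] surjective on [ZC / BC'], whose dimension is thus at
    most that of [ZD / BD]. The quotient by [BC'] is realized by the cokernel matrix [Q]. *)
Lemma subquotient_rank_le (L : fieldType) n m nb mb (ZC : 'M[L]_n)
    (BC' : 'M[L]_(nb, n)) (ZD : 'M[L]_m) (BD : 'M[L]_(mb, m))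
    (al : 'M[L]_(n, m)) (be : 'M[L]_(m, n)) :
  (BC' <= ZC)%MS -> (ZC *m al <= ZD)%MS -> (BD <= ZD)%MS ->
  (BD *m be <= BC')%MS -> (ZC <= ZC *m al *m be + BC')%MS ->
  (\rank ZC - \rank BC' <= \rank ZD - \rank BD)%N.
Proof.
move=> sBZ sZZ sBZD sBB sZ; pose Q := cokermx BC'.
have kerQ p (M : 'M_(p, n)) : (M <= kermx Q)%MS = (M <= BC')%MS.
  by rewrite [RHS]submxE; apply/sub_kermxP/eqP.
have rC : \rank (ZC *m Q) = (\rank ZC - \rank BC')%N.
  rewrite -(mxrank_mul_ker ZC Q); suff -> : \rank (ZC :&: kermx Q) = \rank BC'.
    by rewrite addnK.
  apply: eqmx_rank.
  by rewrite -kerQ capmxSr sub_capmx sBZ kerQ submx_refl.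
have rD : (\rank (ZD *m (be *m Q)) <= \rank ZD - \rank BD)%N.
  rewrite -(mxrank_mul_ker ZD (be *m Q)) leq_subRL; last first.
    by rewrite mxrank_mul_ker mxrankS.
  rewrite addnC leq_add2l mxrankS // sub_capmx sBZD; apply/sub_kermxP.
  by rewrite mulmxA; apply/eqP; rewrite -submxE.
rewrite -rC; apply: leq_trans rD; apply: mxrankS.
apply: submx_trans (submxMr Q sZ) _; rewrite addsmxMr.
rewrite (_ : BC' *m Q = 0) ?addsmx0; last by apply/eqP; rewrite -submxE.
by rewrite -mulmxA submxMr.
Qed.

(** Complexes with a rescaled augmentation, or with some variables set to zero, also serve as
    sources of comparison maps; hence exactness is not part of this record. *)
Record gcomplex (k : fieldType) (A : zmodType) (N : nat) (w : 'I_N -> A) :=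
  GComplex {
  crank : nat -> nat;
  cdeg : forall i, 'I_(crank i) -> A;
  caug : 'cV[{mpoly k[N]}]_(crank 0);
  cdiff : forall i, 'M[{mpoly k[N]}]_(crank i.+1, crank i);
  caug_homogeneous : forall b, homogeneous w (cdeg b) (caug b 0);
  cdiff_homogeneous : forall i,
    homogeneous_mx w (@cdeg i.+1) (@cdeg i) (cdiff i);
  cdiff_aug : cdiff 0 *m caug = 0;
  cdiff_diff : forall i, cdiff i.+1 *m cdiff i = 0
}.

Section Complexes.
Variables (k : fieldType) (A : zmodType) (N : nat) (w : 'I_N -> A).
Implicit Types (K : {mpoly k[N]} -> Prop) (C D : gcomplex k w).

Lemma fdiff_aug K (F : graded_free_resolution w K) : fdiff F 0 *m aug F = 0.
Proof.
apply/row_matrixP => b; rewrite row_mul row0; apply: (aug_exact _).2.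
by exists (delta_mx 0 b); rewrite -rowE.
Qed.

Lemma fdiff_diff K (F : graded_free_resolution w K) i :
  fdiff F i.+1 *m fdiff F i = 0.
Proof.
apply/row_matrixP => b; rewrite row_mul row0; apply: (fdiff_exact _).2.
by exists (delta_mx 0 b); rewrite -rowE.
Qed.

Definition of_resolution K (F : graded_free_resolution w K) : gcomplex k w :=
  {| caug_homogeneous := @aug_homogeneous _ _ _ _ _ F;
     cdiff_homogeneous := @fdiff_homogeneous _ _ _ _ _ F;
     cdiff_aug := fdiff_aug F;
     cdiff_diff := fdiff_diff F |}.

Definition chain_map C D (al : forall i, 'M_(crank C i, crank D i)) :=
  [/\ forall i, homogeneous_mx w (@cdeg _ _ _ _ C i) (@cdeg _ _ _ _ D i) (al i)
    & forall i, al i.+1 *m cdiff D i = cdiff C i *m al i].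

Lemma caug_homogeneous_mx C :
  homogeneous_mx w (@cdeg _ _ _ _ C 0) (fun _ : 'I_1 => 0) (caug C).
Proof. by move=> b j; rewrite subr0 ord1; exact: caug_homogeneous. Qed.

(** The comparison theorem. The invariant keeps the rows of [cdiff C i *m M] in the image of
    [fdiff F i], so that the next map exists by exactness of [F]. *)
Lemma lifting C K (F : graded_free_resolution w K) :
  (forall b, K (caug C b 0)) ->
  exists2 al : forall i, 'M_(crank C i, frank F i),
    @chain_map C (of_resolution F) al & al 0%N *m aug F = caug C.
Proof.
move=> augK.
pose Inv i (M : 'M_(crank C i, frank F i)) :=
  homogeneous_mx w (@cdeg _ _ _ _ C i) (@bdeg _ _ _ _ _ F i) M /\
  forall b, exists v, row b (cdiff C i *m M) = v *m fdiff F i.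
pose R i (M : 'M_(crank C i, frank F i)) (M' : 'M_(crank C i.+1, frank F i.+1)) :=
  M' *m fdiff F i = cdiff C i *m M.
have [||al [al0 hal alS]] :=
    @dependent_choice _ (fun M => M *m aug F = caug C) Inv R.
- have [|V hV eV] := homogeneous_factor
      (@caug_homogeneous_mx C) (@caug_homogeneous_mx (of_resolution F)).
    move=> b; have [v ev] := (aug_image F _).1 (augK b); exists v.
    by apply/matrixP => i j; rewrite !ord1 -ev mxE.
  exists V => //; split=> // b; apply: (aug_exact _).1.
  by rewrite -row_mul -mulmxA -eV cdiff_aug row0.
- move=> i M [hM eM].
  have hd := homogeneous_mulmx (@cdiff_homogeneous _ _ _ _ C i) hM.
  have [V hV eV] := homogeneous_factor hd (@fdiff_homogeneous _ _ _ _ _ F i) eM.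
  exists V => //; split=> // b; apply: (fdiff_exact _).1.
  by rewrite -row_mul -mulmxA -eV mulmxA cdiff_diff mul0mx row0.
by exists al => //; split=> // i; have [] := hal i.
Qed.

(** Lifts are unique up to homotopy: the differential of [F] annihilates
    [ga i.+1 - cdiff C i *m h i], which therefore factors through the next differential. *)
Lemma null_homotopic C K (F : graded_free_resolution w K)
    (ga : forall i, 'M_(crank C i, frank F i)) :
  @chain_map C (of_resolution F) ga -> ga 0%N *m aug F = 0 ->
  exists h : forall i, 'M_(crank C i, frank F i.+1),
    [/\ forall i, homogeneous_mx w (@cdeg _ _ _ _ C i)
                    (@bdeg _ _ _ _ _ F i.+1) (h i),
        ga 0%N = h 0%N *m fdiff F 0
      & forall i, ga i.+1 = h i.+1 *m fdiff F i.+1 + cdiff C i *m h i].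
Proof.
move=> [hga gaS] ga0.
pose Inv i (M : 'M_(crank C i, frank F i.+1)) :=
  homogeneous_mx w (@cdeg _ _ _ _ C i) (@bdeg _ _ _ _ _ F i.+1) M /\
  forall b, exists v, row b (ga i.+1 - cdiff C i *m M) = v *m fdiff F i.+1.
pose R i (M : 'M_(crank C i, frank F i.+1))
    (M' : 'M_(crank C i.+1, frank F i.+2)) :=
  ga i.+1 = M' *m fdiff F i.+1 + cdiff C i *m M.
have [||h [h0 hh hS]] :=
    @dependent_choice _ (fun M => ga 0%N = M *m fdiff F 0) Inv R.
- have [|V hV eV] :=
      homogeneous_factor (hga 0%N) (@fdiff_homogeneous _ _ _ _ _ F 0).
    by move=> b; apply: (aug_exact _).1; rewrite -row_mul ga0 row0.
  exists V => //; split=> // b; apply: (fdiff_exact _).1.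
  by rewrite -row_mul mulmxBl gaS -mulmxA -eV subrr row0.
- move=> i M [hM eM].
  have hd := homogeneous_mxB (hga i.+1)
    (homogeneous_mulmx (@cdiff_homogeneous _ _ _ _ C i) hM).
  have [V hV eV] := homogeneous_factor hd (@fdiff_homogeneous _ _ _ _ _ F i.+1) eM.
  exists V; last by rewrite /R -eV subrK.
  split=> // b; apply: (fdiff_exact _).1.
  rewrite -row_mul mulmxBl gaS -mulmxA -eV mulmxBr mulmxA.
  by rewrite cdiff_diff mul0mx subr0 subrr row0.
by exists h; split=> // i; have [] := hh i.
Qed.

(** Homology in degree [a] of the specialization of a complex along [e]. For
    [e] the constant term these are [tor_cycles] and [tor_boundaries]. *)
Section Specialization.
Variables (L : fieldType) (e : {rmorphism {mpoly k[N]} -> L}).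

Definition spec_part C i (a : A) : 'M[L]_(crank C i) :=
  diag_mx (\row_b (cdeg b == a)%:R).

Definition spec_cycles C i (a : A) : 'M[L]_(crank C i) :=
  match i return 'M[L]_(crank C i) with
  | 0 => spec_part C 0 a
  | j.+1 => (spec_part C j.+1 a :&: kermx (map_mx e (cdiff C j)))%MS
  end.

Definition spec_boundaries C i (a : A) : 'M[L]_(crank C i.+1, crank C i) :=
  spec_part C i.+1 a *m map_mx e (cdiff C i).

Hypothesis eN0 : forall a p, a != 0 -> homogeneous w a p -> e p = 0.

(** An entry between basis vectors of different degrees has nonzero degree and is killed by [e]; so
    the specialized complex is the direct sum of its degree parts. *)
Lemma spec_part_comm p q (dp : 'I_p -> A) (dq : 'I_q -> A) M a :
  homogeneous_mx w dp dq M ->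
  diag_mx (\row_b (dp b == a)%:R) *m map_mx e M =
  map_mx e M *m diag_mx (\row_b (dq b == a)%:R).
Proof.
move=> hM; rewrite mul_diag_mx mul_mx_diag; apply/matrixP => b b'; rewrite !mxE.
have [<- | ne] := eqVneq (dp b) (dq b'); first by rewrite mulrC.
by rewrite (eN0 _ (hM b b')) ?subr_eq0 // mulr0 mul0r.
Qed.

Lemma spec_cycles_part C i a : (spec_cycles C i a <= spec_part C i a)%MS.
Proof. by case: i => [|i] //=; apply: capmxSl. Qed.

Lemma spec_boundaries_cycles C i a :
  (spec_boundaries C i a <= spec_cycles C i a)%MS.
Proof.
have sBP : (spec_boundaries C i a <= spec_part C i a)%MS.
  rewrite /spec_boundaries /spec_part.
  by rewrite (spec_part_comm _ (@cdiff_homogeneous _ _ _ _ C i)) submxMl.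
case: i sBP => //= i sBP; rewrite sub_capmx sBP; apply/sub_kermxP.
by rewrite -mulmxA -map_mxM cdiff_diff map_mx0 mulmx0.
Qed.

Lemma rank_spec_part C i a :
  \rank (spec_part C i a) = #|[pred b : 'I_(crank C i) | cdeg b == a]|.
Proof. exact: rank_diag_pred. Qed.

Lemma chain_map_spec_cycles C D al i a :
  @chain_map C D al ->
  (spec_cycles C i a *m map_mx e (al i) <= spec_cycles D i a)%MS.
Proof.
move=> [hal alS].
have part j : (spec_part C j a *m map_mx e (al j) <= spec_part D j a)%MS.
  by rewrite /spec_part (spec_part_comm _ (hal j)) submxMl.
case: i => [|i] /=; first exact: part.
rewrite sub_capmx (submx_trans (submxMr _ (capmxSl _ _)) (part _)) /=.
apply/sub_kermxP; rewrite -mulmxA -map_mxM alS map_mxM mulmxA.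
by rewrite (sub_kermxP (capmxSr _ _)) mul0mx.
Qed.

Lemma chain_map_spec_boundaries C D al i a :
  @chain_map C D al ->
  (spec_boundaries C i a *m map_mx e (al i) <= spec_boundaries D i a)%MS.
Proof.
move=> [hal alS]; rewrite /spec_boundaries -mulmxA -map_mxM -alS map_mxM mulmxA.
by rewrite /spec_part (spec_part_comm _ (hal i.+1)) -!mulmxA submxMl.
Qed.

(** [be] after [al] is homotopic to [u], so where [u] does not vanish the homology
    of the resolution is a direct summand of that of [D]. *)
Lemma retract_rank K (R : graded_free_resolution w K) D u al be i a :
  let C := of_resolution R in
  @chain_map C D al -> @chain_map D C be -> homogeneous w 0 u -> e u != 0 ->
  al 0%N *m be 0%N *m aug R = u *: aug R ->
  (\rank (spec_cycles C i a) - \rank (spec_boundaries C i a)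
   <= \rank (spec_cycles D i a) - \rank (spec_boundaries D i a))%N.
Proof.
move=> C hal hbe hu eu0 augu.
pose ga j := al j *m be j - u%:M.
have hga : @chain_map C C ga.
  case: hal hbe => [hal alS] [hbe beS]; split=> j.
    by apply/homogeneous_mxB/homogeneous_scalar/hu; apply: homogeneous_mulmx (hal j) (hbe j).
  by rewrite /ga mulmxBl mulmxBr -mulmxA beS !mulmxA alS scalar_mxC.
have [|h [hh h0 hS]] := null_homotopic hga.
  by rewrite mulmxBl augu mul_scalar_mx subrr.
apply: (@subquotient_rank_le _ _ _ _ _ _ _ _ _ (map_mx e (al i)) (map_mx e (be i))).
- exact: spec_boundaries_cycles.
- exact: chain_map_spec_cycles.
- exact: spec_boundaries_cycles.
- exact: chain_map_spec_boundaries.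
set Z := spec_cycles C i a.
(* On cycles only the term of the homotopy formula that ends in the differential of [C] survives,
   and it is a boundary. *)
have Zga : (Z *m map_mx e (ga i) <= spec_boundaries C i a)%MS.
  have part : (Z *m map_mx e (h i) *m map_mx e (cdiff C i) <= spec_boundaries C i a)%MS.
    rewrite submxMr //; apply: submx_trans (submxMr _ (spec_cycles_part _ _ _)) _.
    by rewrite /spec_part (spec_part_comm _ (hh i)) submxMl.
  case: i h0 hS @Z part => [|i] h0 hS Z part; first by rewrite h0 map_mxM mulmxA.
  rewrite hS map_mxD map_mxM [map_mx e (cdiff C i *m _)]map_mxM mulmxDr.
  have Zd : Z *m map_mx e (cdiff C i) = 0 by apply/sub_kermxP/capmxSr.
  by rewrite [X in _ + X]mulmxA Zd mul0mx addr0 mulmxA.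
(* Scaling by the nonzero [e u] keeps the row space of [Z], and [e u *: Z] is the image of [Z] under
   the composite minus a boundary. *)
have -> : (Z <= Z *m map_mx e (al i) *m map_mx e (be i) + spec_boundaries C i a)%MS
   = (e u *: Z <= Z *m map_mx e (al i) *m map_mx e (be i) + spec_boundaries C i a)%MS.
  by rewrite (eqmx_scale _ eu0).
have -> : e u *: Z = Z *m map_mx e (al i) *m map_mx e (be i) - Z *m map_mx e (ga i).
  rewrite -mulmxA -map_mxM -mulmxBr -map_mxB /ga subKr map_scalar_mx.
  by rewrite mul_mx_scalar.
by rewrite addmx_sub_adds // eqmx_opp.
Qed.

End Specialization.
End Complexes.

(** * Mapping cones *)

(** The monomials [cells i] are the multidegrees of a basis of [F_i]; this way
    one list serves every grading [w]. *)
Definition resolved (k : fieldType) (A : zmodType) (N : nat) (w : 'I_N -> A)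
    (K : {mpoly k[N]} -> Prop) (cells : nat -> seq 'X_{1..N}) :=
  exists F : graded_free_resolution w K,
    forall i, [seq bdeg b | b : 'I_(frank F i)] = map (wdeg w) (cells i).

Lemma enum_ord_add p q :
  enum 'I_(p + q) = map (@lshift p q) (enum 'I_p) ++ map (@rshift p q) (enum 'I_q).
Proof.
apply: (inj_map (@ord_inj (p + q))); rewrite [LHS]val_enum_ord iotaD map_cat.
congr (_ ++ _); first by rewrite -(val_enum_ord p) -[RHS]map_comp; apply: eq_map.
rewrite -[(0 + p)%N]addn0 add0n iotaDl -(val_enum_ord q).
by rewrite -[LHS]map_comp -[RHS]map_comp; apply: eq_map.
Qed.

Section MappingCone.
Variables (k : fieldType) (A : zmodType) (N : nat) (w : 'I_N -> A).
Variables (K Kf K' : {mpoly k[N]} -> Prop) (f : 'X_{1..N}).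
Variables (F : graded_free_resolution w K) (G : graded_free_resolution w Kf).
Hypothesis colonP : forall p, Kf p <-> K (p * 'X_[f]).
Hypothesis sumP : forall p, K' p <-> exists q r, K q /\ p = q + r * 'X_[f].

Let a := wdeg w f.
(** The resolution of [S / Kf] with degrees shifted by that of [f]: position 0 is [S], and the
    augmentation of [G] becomes the first differential. *)
Let grank i := if i is j.+1 then frank G j else 1%N.
Let gdeg i : 'I_(grank i) -> A :=
  match i with 0 => fun _ => a | j.+1 => fun b => a + @bdeg _ _ _ _ _ G j b end.
Let gdiff i : 'M[{mpoly k[N]}]_(grank i.+1, grank i) :=
  match i with 0 => aug G | j.+1 => fdiff G j end.

Lemma gdiff_homogeneous i :
  homogeneous_mx w (@gdeg i.+1) (@gdeg i) (gdiff i).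
Proof.
move=> b b'; case: i b b' => [|i] b b' /=; rewrite ?ord1.
  by rewrite addrAC subrr add0r; apply: aug_homogeneous.
by rewrite opprD addrACA subrr add0r; apply: fdiff_homogeneous.
Qed.

Lemma gdiff_diff i : gdiff i.+1 *m gdiff i = 0.
Proof. by case: i => [|i]; [apply: fdiff_aug | apply: fdiff_diff]. Qed.

Lemma gdiff_exact i (u : 'rV_(grank i.+1)) :
  u *m gdiff i = 0 -> exists v : 'rV_(grank i.+2), u = v *m gdiff i.+1.
Proof. by case: i u => [|i] u /=; [apply: (aug_exact _).1 | apply: (fdiff_exact _).1]. Qed.

Lemma cone_comparison_subproof b : homogeneous w (@gdeg 1 b) (('X_[f] *: aug G) b 0).
Proof. by rewrite mxE; apply/homogeneousM/aug_homogeneous; apply: homogeneousX. Qed.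

(** Multiplication by [f] carries [Kf] into [K], and this map is lifted to the resolutions. *)
Lemma cone_comparison :
  exists2 al : forall i, 'M_(grank i.+1, frank F i),
    (forall i, homogeneous_mx w (@gdeg i.+1) (@bdeg _ _ _ _ _ F i) (al i)) /\
    (forall i, al i.+1 *m fdiff F i = gdiff i.+1 *m al i)
    & al 0%N *m aug F = 'X_[f] *: aug G.
Proof.
have daug : fdiff G 0 *m ('X_[f] *: aug G) = 0.
  by rewrite -scalemxAr fdiff_aug scaler0.
pose C : gcomplex k w :=
  {| caug_homogeneous := cone_comparison_subproof;
     cdiff_homogeneous := fun i => @gdiff_homogeneous i.+1;
     cdiff_aug := daug;
     cdiff_diff := fun i => fdiff_diff G i |}.
have [|al [hal alS] al0] := @lifting _ _ _ _ C _ F.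
  move=> b; rewrite mxE mulrC; apply/colonP; apply/(aug_image G).
  by exists (delta_mx 0 b); rewrite -rowE mxE.
by exists al.
Qed.

(** The cone of multiplication by [f] from [S / Kf] to [S / K]. This map is injective because [Kf]
    is the colon ideal, and its cokernel is [S / K']; so the cone is exact. *)
Lemma mapping_cone_exists :
  exists M : graded_free_resolution w K',
    forall i, [seq bdeg b | b : 'I_(frank M i)] =
      [seq bdeg b | b : 'I_(frank F i)] ++ [seq gdeg b | b : 'I_(grank i)].
Proof.
have [al [hal alS] al0] := cone_comparison.
pose mrank i := (frank F i + grank i)%N.
pose mdegr i (b : 'I_(mrank i)) : A :=
  match split b with inl c => bdeg c | inr c => gdeg c end.
have mdegl i c : mdegr i (lshift _ c) = bdeg c by rewrite /mdegr (unsplitK (inl _)).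
have mdegrr i c : mdegr i (rshift _ c) = gdeg c by rewrite /mdegr (unsplitK (inr _)).
pose maug : 'cV[{mpoly k[N]}]_(mrank 0) := col_mx (aug F) ('X_[f])%:M.
pose mdiff i : 'M[{mpoly k[N]}]_(mrank i.+1, mrank i) :=
  block_mx (fdiff F i) 0 (al i) (- gdiff i).
have maug_hom b : homogeneous w (mdegr 0%N b) (maug b 0).
  have [c ->|c ->] := split_ordP b; rewrite ?mdegl ?mdegrr.
    by rewrite col_mxEu; apply: aug_homogeneous.
  by rewrite col_mxEd ord1 mxE eqxx; apply: homogeneousX.
have mdiff_hom i b b' : homogeneous w (mdegr i.+1 b - mdegr i b') (mdiff i b b').
  have [c ->|c ->] := split_ordP b; have [c' ->|c' ->] := split_ordP b';
    rewrite ?mdegl ?mdegrr ?block_mxEul ?block_mxEur ?block_mxEdl ?block_mxEdr.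
  - exact: fdiff_homogeneous.
  - by rewrite mxE; apply: homogeneous0.
  - exact: hal.
  - by rewrite mxE; apply/homogeneousN/gdiff_homogeneous.
have maugE (u : 'rV_(mrank 0)) :
    (u *m maug) = lsubmx u *m aug F + rsubmx u *m ('X_[f])%:M.
  by rewrite -mul_row_col hsubmxK.
have scalar1 (p : {mpoly k[N]}) (u : 'rV_1) : (u *m p%:M) 0 0 = u 0 0 * p.
  by rewrite mul_mx_scalar mxE mulrC.
have mdiffE i (u : 'rV_(mrank i.+1)) : u *m mdiff i =
    row_mx (lsubmx u *m fdiff F i + rsubmx u *m al i) (- (rsubmx u *m gdiff i)).
  by rewrite -[in LHS](hsubmxK u) mul_row_block mulmx0 add0r mulmxN.
have maug_image p : K' p <-> exists u : 'rV_(mrank 0), p = (u *m maug) 0 0.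
  rewrite sumP; split=> [[q [r [/(aug_image F)[v ->] ->]]] | [u ->]].
    exists (row_mx v r%:M); rewrite maugE row_mxKl row_mxKr [RHS]mxE scalar1 [r%:M 0 0]mxE.
    by rewrite eqxx.
  exists ((lsubmx u *m aug F) 0 0), (rsubmx u 0 0); split; last first.
    by rewrite maugE mxE scalar1.
  by apply/(aug_image F); exists (lsubmx u).
have maug_exact (u : 'rV_(mrank 0)) :
    u *m maug = 0 <-> exists v : 'rV_(mrank 1), u = v *m mdiff 0%N.
  split=> [u0 | [v ->]].
    have eu : lsubmx u *m aug F + rsubmx u *m ('X_[f])%:M = 0 by rewrite -maugE.
    (* A relation [q + r * 'X_[f] = 0] with [q] in [K] puts [r] in the colon ideal. Lifting [r] to
       [z] along the augmentation of [G] and adding the comparison image of [z] gives a cycle of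
       [F]. *)
    have /(aug_image G)[z ez] : Kf (rsubmx u 0 0).
      apply/colonP; rewrite -scalar1; apply/(aug_image F).
      by exists (- lsubmx u); rewrite mulNmx (addr0_eq eu).
    have ez' : rsubmx u = z *m gdiff 0 by apply/rowP => j; rewrite !ord1.
    have /(aug_exact _).1[y ey] : (lsubmx u + z *m al 0%N) *m aug F = 0.
      rewrite mulmxDl -mulmxA al0 -scalemxAr -[RHS]eu ez' mul_mx_scalar.
      by [].
    exists (row_mx y (- z)); rewrite mdiffE row_mxKl row_mxKr !mulNmx opprK -ez'.
    by rewrite -ey addrK hsubmxK.
  rewrite mdiffE maugE row_mxKl row_mxKr mulmxDl -[_ *m fdiff F 0 *m _]mulmxA.
  rewrite fdiff_aug mulmx0 add0r -mulmxA al0 mul_mx_scalar scalerN -scalemxAr.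
  exact: subrr.
have mdiff_exact i (u : 'rV_(mrank i.+1)) :
    u *m mdiff i = 0 <-> exists v : 'rV_(mrank i.+2), u = v *m mdiff i.+1.
  split=> [u0 | [v ->]].
    have /eq_row_mx[eu1 /eqP eu2] : row_mx (lsubmx u *m fdiff F i + rsubmx u *m al i)
        (- (rsubmx u *m gdiff i)) = row_mx 0 0 by rewrite -mdiffE row_mx0.
    have [z ez] : exists z : 'rV_(grank i.+2), rsubmx u = z *m gdiff i.+1.
      by apply: gdiff_exact; apply/eqP; rewrite -oppr_eq0.
    have /(fdiff_exact _).1[y ey] : (lsubmx u + z *m al i.+1) *m fdiff F i = 0.
      by rewrite mulmxDl -mulmxA alS mulmxA -ez.
    exists (row_mx y (- z)); rewrite mdiffE row_mxKl row_mxKr !mulNmx opprK -ez.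
    by rewrite -ey addrK hsubmxK.
  rewrite !mdiffE row_mxKl row_mxKr mulmxDl !mulNmx -!mulmxA (fdiff_diff F) alS.
  by rewrite gdiff_diff !mulmx0 !oppr0 add0r subrr row_mx0.
exists (GradedFreeResolution maug_hom mdiff_hom maug_image maug_exact mdiff_exact).
move=> i; rewrite /image_mem [enum _]enum_ord_add map_cat -!map_comp.
by congr (_ ++ _); apply: eq_map => c; rewrite /= ?mdegl ?mdegrr.
Qed.

End MappingCone.

Section Resolved.
Variables (k : fieldType) (A : zmodType) (N : nat) (w : 'I_N -> A).
Implicit Types (K : {mpoly k[N]} -> Prop) (cs ds : nat -> seq 'X_{1..N}).

Lemma resolved_cone K Kf K' f cs ds :
  resolved w K cs -> resolved w Kf ds ->
  (forall p, Kf p <-> K (p * 'X_[f])) ->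
  (forall p, K' p <-> exists q r, K q /\ p = q + r * 'X_[f]) ->
  resolved w K' (fun i => cs i ++
    [seq (f + m)%MM | m <- if i is j.+1 then ds j else [:: 0%MM]]).
Proof.
move=> [F eF] [G eG] colonP sumP.
have [M eM] := mapping_cone_exists F G colonP sumP; exists M => i.
rewrite eM map_cat eF; congr (_ ++ _); case: i => [|i] /=.
  by rewrite /image_mem enum_ordSl enum_ord0 /= wdegD wdeg0 addr0.
rewrite -map_comp (eq_map (g := +%R (wdeg w f) \o wdeg w)); last first.
  by move=> m /=; rewrite wdegD.
by rewrite [RHS]map_comp -eG /image_mem -[RHS]map_comp.
Qed.

Lemma resolved_zero K : (forall p, K p <-> p = 0) ->
  resolved w K (fun=> [::]).
Proof.
move=> K0.
have [F eF] : exists F : graded_free_resolution w K, frank F = fun=> 0%N.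
  unshelve eexists (@GradedFreeResolution k A N w K (fun=> 0%N) (fun=> fun=> 0) 0
     (fun=> 0) _ _ _ _ _); rewrite //=.
  - by case.
  - by move=> i [].
  - by move=> p; rewrite K0; split=> [->|[u ->]]; [exists 0|]; rewrite mulmx0 mxE.
  - by move=> u; split=> _; [exists 0 | rewrite mulmx0]; rewrite ?thinmx0 // mulmx0.
  - by move=> i u; split=> _; [exists 0|]; rewrite ?mulmx0 // thinmx0.
exists F => i; apply/size0nil; rewrite /image_mem size_map size_enum_ord.
by rewrite eF.
Qed.

Lemma resolved_iff K K' cs : (forall p, K p <-> K' p) ->
  resolved w K cs -> resolved w K' cs.
Proof.
move=> KK' [F eF]; have imF p : K' p <-> exists u : 'rV_(frank F 0), p = (u *m aug F) 0 0.
  by rewrite -KK'; apply: aug_image.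
by exists (GradedFreeResolution (@aug_homogeneous _ _ _ _ _ F)
  (@fdiff_homogeneous _ _ _ _ _ F) imF (@aug_exact _ _ _ _ _ F) (@fdiff_exact _ _ _ _ _ F)).
Qed.

End Resolved.

(** * Resolutions of monomial ideals *)

Section MonomialIdeals.
Variables (k : fieldType) (N : nat).
Implicit Types (p q : {mpoly k[N]}) (ms us : seq 'X_{1..N}).

Definition divisible ms (mon : 'X_{1..N}) := has (fun m => (m <= mon)%MM) ms.

(** Testing membership on monomials reduces colons and sums of these ideals to divisibility of
    exponents. *)
Definition monomial_ideal ms p := forall mon, mon \in msupp p -> divisible ms mon.

Lemma divisibleD ms m mon : divisible ms mon -> divisible ms (m + mon)%MM.
Proof.
move=> /hasP[m' ms_m' le]; apply/hasP; exists m' => //.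
by apply: lepm_trans le _; apply/mnm_lepP => i; rewrite mnmDE leq_addl.
Qed.

Lemma monomial_ideal_nil p : monomial_ideal [::] p <-> p = 0.
Proof.
split=> [p0 | ->]; last by move=> mon; rewrite msupp0.
by apply/msuppnil0; case E: (msupp p) p0 => [|mon s] // /(_ mon); rewrite E mem_head => /(_ isT).
Qed.

Lemma monomial_idealD ms p q :
  monomial_ideal ms p -> monomial_ideal ms q -> monomial_ideal ms (p + q).
Proof. by move=> hp hq mon /msuppD_le; rewrite mem_cat => /orP[/hp | /hq]. Qed.

Lemma monomial_idealM ms p q : monomial_ideal ms q -> monomial_ideal ms (p * q).
Proof.
by move=> hq mon /msuppM_le /allpairsP[[m1 m2] /= [_ /hq + ->]]; apply: divisibleD.
Qed.

Lemma monomial_idealX ms mon : divisible ms mon -> monomial_ideal ms 'X_[mon].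
Proof. by move=> dmon m; rewrite msuppX inE => /eqP ->. Qed.

Lemma monomial_ideal_sum ms (I : Type) (r : seq I) (P : pred I) (F : I -> {mpoly k[N]}) :
  (forall i, P i -> monomial_ideal ms (F i)) ->
  monomial_ideal ms (\sum_(i <- r | P i) F i).
Proof.
move=> hF; elim/big_ind: _ => //; last exact: monomial_idealD.
by move=> mon; rewrite msupp0.
Qed.

Lemma monomial_ideal_colon ms us f p :
  (forall mon, divisible us mon = divisible ms (f + mon)%MM) ->
  monomial_ideal us p <-> monomial_ideal ms (p * 'X_[f]).
Proof.
move=> usE; split=> hp mon.
  by rewrite (perm_mem (msuppMX _ _)) => /mapP[m' /hp]; rewrite usE => + ->.
move=> p_mon; rewrite usE; apply: hp.
by rewrite (perm_mem (msuppMX _ _)); apply: map_f.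
Qed.

Lemma monomial_ideal_cons ms f p :
  monomial_ideal (f :: ms) p <->
  exists q r, monomial_ideal ms q /\ p = q + r * 'X_[f].
Proof.
split=> [hp | [q [r [hq ->]]]].
  (* The monomials of [p] not divisible by [f] form [q]; the others, divided by [f], form [r]. *)
  exists (\sum_(m <- msupp p | ~~ (f <= m)%MM) p@_m *: 'X_[m]).
  exists (\sum_(m <- msupp p | (f <= m)%MM) p@_m *: 'X_[m - f]); split.
    rewrite big_seq_cond; apply: monomial_ideal_sum => m /andP[/hp + nf].
    rewrite /divisible /= (negPf nf) /= => dm; rewrite -mul_mpolyC.
    exact/monomial_idealM/monomial_idealX.
  rewrite [LHS]mpolyE (bigID (fun m => f <= m)%MM) /= addrC; congr (_ + _).
  rewrite mulr_suml; apply: eq_bigr => m le_fm.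
  by rewrite -scalerAl -mpolyXD submK.
apply: monomial_idealD.
  by move=> mon /hq dm; rewrite /divisible /= [has _ _]dm orbT.
by apply/monomial_idealM/monomial_idealX; rewrite /divisible /= lepm_refl.
Qed.

(** Multidegrees of the Koszul complex on the variables [U]. *)
Fixpoint subset_cells (U : seq 'I_N) (i : nat) {struct U} : seq 'X_{1..N} :=
  match U, i with
  | _, 0 => [:: 0%MM]
  | [::], _.+1 => [::]
  | z :: U', j.+1 =>
      subset_cells U' j.+1 ++ [seq (U_(z) + mon)%MM | mon <- subset_cells U' j]
  end.

Lemma subset_cells0 U : subset_cells U 0 = [:: 0%MM].
Proof. by case: U. Qed.

Variables (A : zmodType) (w : 'I_N -> A).

Lemma resolved_eq (K : {mpoly k[N]} -> Prop) (cs ds : nat -> seq 'X_{1..N}) :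
  cs =1 ds -> resolved w K cs -> resolved w K ds.
Proof. by move=> eq_cs [F eF]; exists F => i; rewrite -eq_cs. Qed.

(** Mapping cones, by induction on the number of generators. The colon ideal by [f] is generated by
    the [m - f]; the subtraction is truncated, so this is the exponent of [m] divided by its gcd
    with [f]. *)
Lemma resolved_monomial_ideal ms :
  exists cs, resolved w (monomial_ideal ms) cs.
Proof.
have [s] := ubnP (size ms); elim: s ms => // s IHs [|f ms] /= lt_s.
  by exists (fun=> [::]); apply: resolved_zero => p; apply: monomial_ideal_nil.
have [cs hcs] := IHs ms lt_s.
have [|ds hds] := IHs [seq (m - f)%MM | m <- ms]; first by rewrite size_map.
eexists; apply: resolved_cone hcs hds _ (@monomial_ideal_cons ms f) => p.
apply: monomial_ideal_colon => mon; rewrite /divisible has_map; apply: eq_has => m /=.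
by apply/mnm_lepP/mnm_lepP => le i; have := le i; rewrite mnmBE mnmDE leq_subLR.
Qed.

(** The nonempty Koszul cells of [U] resolve the colon ideal; the cone puts the empty cell in front,
    so that all cells of [U] occur, shifted by [f]. *)
Lemma resolved_linear_quotient ms (f : 'X_{1..N}) U cs :
  resolved w (monomial_ideal ms) cs ->
  resolved w (monomial_ideal [seq U_(z)%MM | z <- U])
    (fun i => subset_cells U i.+1) ->
  (forall mon : 'X_{1..N}, has (fun z => 0 < mon z)%N U = divisible ms (f + mon)%MM) ->
  resolved w (monomial_ideal (f :: ms))
    (fun i => cs i ++ [seq (f + mon)%MM | mon <- subset_cells U i]).
Proof.
move=> hcs hU colonU.
apply: (@resolved_eq _ (fun i => cs i ++ [seq (f + m)%MM |
   m <- if i is j.+1 then subset_cells U j.+1 else [:: 0%MM]])).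
  by case=> [|i] //; rewrite subset_cells0.
apply: resolved_cone hcs hU _ (@monomial_ideal_cons ms f) => p.
apply: monomial_ideal_colon => mon; rewrite -colonU /divisible has_map.
by apply: eq_has => z /=; rewrite lep1mP lt0n.
Qed.

(** A variable outside a set of variables is a nonzerodivisor modulo their ideal, so the colon ideal
    is that ideal itself. *)
Lemma resolved_variables U : uniq U ->
  resolved w (monomial_ideal [seq U_(z)%MM | z <- U])
    (fun i => subset_cells U i.+1).
Proof.
elim: U => [_|z U IHU /= /andP[zU uU]].
  by apply: resolved_zero => p; apply: monomial_ideal_nil.
apply: resolved_linear_quotient (IHU uU) (IHU uU) _ => mon.
rewrite /divisible has_map; apply: eq_in_has => z' Uz' /=.
rewrite lep1mP mnmDE mnm1E; case: (z =P z') => [zz'|_]; last by rewrite lt0n.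
by rewrite zz' Uz' in zU.
Qed.

Lemma mdeg_subset_cells U i mon : mon \in subset_cells U i -> mdeg mon = i.
Proof.
elim: U i mon => [|z U IHU] [|i] mon //=; try by move=> /[!inE] /eqP ->; rewrite mdeg0.
rewrite mem_cat => /orP[/IHU // | /mapP[mon' /IHU e ->]].
by rewrite mdegD mdeg1 e.
Qed.

Lemma supp_subset_cells U i mon z :
  mon \in subset_cells U i -> (0 < mon z)%N -> z \in U.
Proof.
elim: U i mon => [|z' U IHU] [|i] mon //=; try by move=> /[!inE] /eqP ->; rewrite mnm0E.
rewrite inE mem_cat => /orP[/IHU h /h -> | /mapP[mon' /IHU h ->]]; first by rewrite orbT.
rewrite mnmDE mnm1E; case: (eqVneq z' z) => //= _.
Qed.

End MonomialIdeals.

(** * Graphs with nested neighbourhoods *)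

Section NestedGraphs.
Variables (k : fieldType) (n m : nat).

Definition edge_mon (a : 'I_n) (b : 'I_m) : 'X_{1..n + m} :=
  (U_(lshift m a) + U_(rshift n b))%MM.

Lemma edge_monxE a b r : edge_mon a b (lshift m r) = (a == r).
Proof. by rewrite mnmDE !mnm1E eq_lshift eq_rlshift addn0. Qed.

Lemma edge_monyE a b c : edge_mon a b (rshift n c) = (b == c).
Proof. by rewrite mnmDE !mnm1E eq_rshift eq_lrshift. Qed.

Lemma edge_monDx a b mon r :
  (edge_mon a b + mon)%MM (lshift m r) = ((a == r) + mon (lshift m r))%N.
Proof. by rewrite mnmDE edge_monxE. Qed.

Lemma edge_monDy a b mon c :
  (edge_mon a b + mon)%MM (rshift n c) = ((b == c) + mon (rshift n c))%N.
Proof. by rewrite mnmDE edge_monyE. Qed.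

Lemma edge_mon_le a b (mon : 'X_{1..n + m}) :
  (edge_mon a b <= mon)%MM = (0 < mon (lshift m a))%N && (0 < mon (rshift n b))%N.
Proof.
apply/mnm_lepP/andP=> [le | [xa yb] v].
  by have := le (lshift m a); have := le (rshift n b); rewrite edge_monxE edge_monyE !eqxx.
have [r ->|c ->] := split_ordP v.
  by rewrite edge_monxE; case: eqP => // <-.
by rewrite edge_monyE; case: eqP => // <-.
Qed.

Lemma edge_monX a b : xvar k m a * yvar k n b = 'X_[edge_mon a b].
Proof. by rewrite mpolyXD. Qed.

Lemma edge_idealP (G : bigraph n m) ms (p : {mpoly k[n + m]}) :
  (forall mon, reflect (exists2 e, e \in G & mon = edge_mon e.1 e.2) (mon \in ms)) ->
  edge_ideal G p <-> monomial_ideal ms p.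
Proof.
move=> msP; split=> [[c ->] | hp].
  apply: monomial_ideal_sum => e Ge; apply: monomial_idealM.
  rewrite edge_monX; apply: monomial_idealX; apply/hasP.
  by exists (edge_mon e.1 e.2); [apply/msP; exists e | exact: lepm_refl].
rewrite [p]mpolyE big_seq; apply: (big_ind (edge_ideal G)).
- by exists (fun=> 0); rewrite big1 // => e _; rewrite mul0r.
- move=> _ _ [c ->] [d ->]; exists (fun e => c e + d e).
  by rewrite -big_split; apply: eq_bigr => e _; rewrite mulrDl.
move=> mon /hp /hasP[_ /msP[e Ge ->] le].
exists (fun e' => if e' == e then p@_mon *: 'X_[mon - edge_mon e.1 e.2] else 0).
rewrite (bigD1 e) //= eqxx big1 ?addr0 => [|e' /andP[_ /negPf ->]]; last by rewrite mul0r.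
by rewrite edge_monX -scalerAl -mpolyXD submK.
Qed.

Variable ys : 'I_n -> seq 'I_m.

Definition row_gens a (l : seq 'I_m) := [seq edge_mon a b | b <- l].

Definition nested_gens rs := flatten [seq row_gens a (ys a) | a <- rs].

(** Generators of the colon ideal when an edge at [x_a] is adjoined: the [x_r] of the rows already
    present, and the [y_c] of the edges at [x_a] already present. *)
Definition colon_vars rs (l : seq 'I_m) : seq 'I_(n + m) :=
  map (@lshift n m) rs ++ map (@rshift n m) l.

Fixpoint row_cells a rs l i base : seq 'X_{1..n + m} :=
  if l is b :: l' then row_cells a rs l' i base ++
    [seq (edge_mon a b + mon)%MM | mon <- subset_cells (colon_vars rs l') i]
  else base.

Fixpoint nested_cells rs i : seq 'X_{1..n + m} :=
  if rs is a :: rs' then row_cells a rs' (ys a) i (nested_cells rs' i) else [::].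

(** The head of [rs] has the smallest row. Rows are adjoined to the ideal from
    the last to the first, so that the colon ideals are generated by
    [colon_vars]. *)
Definition nested rs := pairwise (fun a a' => all (mem (ys a')) (ys a)) rs.

Hypothesis ys_uniq : forall a, uniq (ys a).

Lemma nested_gensP rs mon :
  reflect (exists2 e, (e.1 \in rs) && (e.2 \in ys e.1) & mon = edge_mon e.1 e.2)
          (mon \in nested_gens rs).
Proof.
apply: (iffP flatten_mapP) => [[a rs_a /mapP[b ab ->]] | [[a b] /= /andP[rs_a ab] ->]].
  by exists (a, b); rewrite ?rs_a.
by exists a => //; apply: map_f.
Qed.

Lemma colon_vars_uniq rs l : uniq rs -> uniq l -> uniq (colon_vars rs l).
Proof.
move=> urs ul; rewrite cat_uniq !map_inj_uniq ?urs ?ul ?andbT //=.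
- by apply/hasPn => _ /mapP[b _ ->]; apply/mapP => -[a _ /eqP]; rewrite eq_rlshift.
- exact: rshift_inj.
- exact: lshift_inj.
Qed.

(** When [x_a y_b] is adjoined, [x_r] is in the colon ideal because nesting puts [b] in row [r], and
    [y_c] because [x_a y_c] is present. Conversely, an earlier generator dividing a multiple of
    [x_a y_b] forces one of these variables, as [a] is not in [rs] and [b] not in [l]. *)
Lemma resolved_nested (A : zmodType) (w : 'I_(n + m) -> A) rs :
  uniq rs -> nested rs ->
  @resolved k A _ w (monomial_ideal (nested_gens rs)) (nested_cells rs).
Proof.
rewrite /nested; elim: rs => [_ _|a rs IHrs /= /andP[ars urs] /andP[/allP nest_a nest]].
  by apply: resolved_zero => p; apply: monomial_ideal_nil.
have {IHrs} IHrs := IHrs urs nest.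
suff: forall l, uniq l -> {subset l <= ys a} ->
    @resolved k A _ w (monomial_ideal (row_gens a l ++ nested_gens rs))
      (fun i => row_cells a rs l i (nested_cells rs i)).
  by apply => //; apply: ys_uniq.
elim=> [_ _|b l IHl /= /andP[bl ul] sub]; first exact: IHrs.
 have {IHl} IHl := IHl ul (fun c lc => sub c (@mem_behead _ (b :: l) c lc)).
apply: resolved_linear_quotient IHl (resolved_variables _ _ (colon_vars_uniq urs ul)) _.
move=> mon; rewrite /divisible has_cat has_map.
apply/hasP/orP=> [[z zU mon_z] | ].
  move: zU; rewrite mem_cat => /orP[] /mapP[c cU zE]; rewrite {}zE in mon_z.
    right; apply/hasP; exists (edge_mon c b).
      apply/nested_gensP; exists (c, b); rewrite //= cU /=.
      by apply: (allP (nest_a c cU)); apply: sub; exact: mem_head.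
    by rewrite edge_mon_le edge_monDx edge_monDy eqxx ltn_addl.
  left; apply/hasP; exists c => //=.
  by rewrite edge_mon_le edge_monDx edge_monDy eqxx add1n ltnS leq0n ltn_addl.
case=> /hasP[].
  move=> c lc /=; rewrite edge_mon_le edge_monDy => /andP[_].
  case: (eqVneq b c) => [bc | _ yc]; first by rewrite bc lc in bl.
  by exists (rshift n c) => //; rewrite mem_cat map_f ?orbT.
move=> _ /nested_gensP[[c d] /= /andP[cU _] ->].
rewrite edge_mon_le edge_monDx => /andP[+ _].
case: (eqVneq a c) => [ac | _ xc]; first by rewrite ac cU in ars.
by exists (lshift m c) => //; rewrite mem_cat map_f.
Qed.

Lemma row_cells_ind (P : 'X_{1..n + m} -> Prop) a rs l i base :
  (forall mon, mon \in base -> P mon) ->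
  (forall b l' mon, b \in l -> {subset l' <= l} ->
     mon \in subset_cells (colon_vars rs l') i -> P (edge_mon a b + mon)%MM) ->
  forall mon, mon \in row_cells a rs l i base -> P mon.
Proof.
move=> Pbase; elim: l => [|b l IHl] Pl mon /=; first exact: Pbase.
rewrite mem_cat => /orP[|/mapP[mon' mon'P ->]].
  apply: IHl => c l' mon' lc sub; apply: Pl; first by rewrite inE lc orbT.
  by move=> d /sub ld; rewrite inE ld orbT.
by apply: (Pl b l) => // [|d ld]; rewrite inE ?eqxx // ld orbT.
Qed.

(** The resolution is linear, so in the fine grading the entries of its differential are scalar
    multiples of variables. *)
Lemma mdeg_nested_cells rs i mon : mon \in nested_cells rs i -> mdeg mon = i.+2.
Proof.
elim: rs mon => //= a rs IHrs; apply: row_cells_ind => // b l mon _ _ /mdeg_subset_cells.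
by rewrite !mdegD !mdeg1 => ->.
Qed.

Lemma supp_nested_cells_rows rs i mon r :
  mon \in nested_cells rs i -> (0 < mon (lshift m r))%N -> r \in rs.
Proof.
move=> mon_rs; move: mon mon_rs r; elim: rs => //= a rs IHrs.
apply: row_cells_ind => [mon /IHrs h r /h | b l mon _ _ monP r].
  by rewrite inE => ->; rewrite orbT.
rewrite edge_monDx inE; case: (eqVneq a r) => //= _ xr.
have := supp_subset_cells monP xr; rewrite mem_cat => /orP[] /mapP[c rs_c /eqP].
  by rewrite eq_lshift => /eqP ->.
by rewrite eq_lrshift.
Qed.

(** The columns of a cell adjoined with row [a] lie in row [a], and its other rows come later in
    [rs], hence contain row [a]. *)
Lemma supp_nested_cells rs i mon r b : nested rs ->
  mon \in nested_cells rs i -> (0 < mon (lshift m r))%N ->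
  (0 < mon (rshift n b))%N -> b \in ys r.
Proof.
move=> + mon_rs; move: mon mon_rs r b; rewrite /nested; elim: rs => //= a rs IHrs.
apply: row_cells_ind => [mon /IHrs h r b /andP[_ /h] | b l mon ab sub monP r c]; first exact.
move=> /andP[/allP nest_a _] xr yc.
have {xr} rP : r = a \/ r \in rs.
  move: xr; rewrite edge_monDx; case: (eqVneq a r) => [->|_ /= xr]; first by left.
  right; have := supp_subset_cells monP xr; rewrite mem_cat => /orP[] /mapP[d rs_d /eqP].
    by rewrite eq_lshift => /eqP ->.
  by rewrite eq_lrshift.
have {yc} ac : c \in ys a.
  move: yc; rewrite edge_monDy; case: (eqVneq b c) => [<-//|_ /= yc].
  apply: sub; have := supp_subset_cells monP yc; rewrite mem_cat => /orP[] /mapP[d rs_d /eqP].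
    by rewrite eq_rlshift.
  by rewrite eq_rshift => /eqP ->.
by case: rP => [-> // | /nest_a /allP]; apply.
Qed.

End NestedGraphs.

(** * Counting the multidegrees with a given x-part *)

Section Counting.
Variables (n m : nat).
Implicit Types (X : {set 'I_n}) (mon : 'X_{1..n + m}).

Definition xsupport X mon := [forall r, mon (lshift m r) == (r \in X)].

Lemma xsupport0 X : xsupport X 0%MM = (X == set0).
Proof.
apply/forallP/eqP=> [h | -> r]; last by rewrite mnm0E inE.
by apply/setP => r; have := h r; rewrite mnm0E inE; case: (r \in X).
Qed.

Lemma xsupport_add X mon mon' a :
  (forall r, mon' (lshift m r) = (a == r) + mon (lshift m r))%N ->
  xsupport X mon' = (a \in X) && xsupport (X :\ a) mon.
Proof.
move=> mon'E; apply/forallP/andP => [h | [aX /forallP h] r].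
  have ha := h a; rewrite mon'E eqxx add1n in ha.
  have aX : a \in X by case: (a \in X) ha.
  split=> //; apply/forallP => r; have := h r; rewrite mon'E !inE.
  case: (eqVneq a r) => [<- | _]; last by rewrite add0n.
  by rewrite aX add1n eqSS.
rewrite mon'E; have := h r; rewrite !inE.
by case: (eqVneq a r) => [<- /= | _ /=]; rewrite ?aX ?add1n ?eqSS ?add0n.
Qed.

Lemma size_subset_cells (U : seq 'I_(n + m)) i :
  size (subset_cells U i) = 'C(size U, i).
Proof.
elim: U i => [|z U IHU] [|i] //=.
by rewrite size_cat size_map !IHU binS.
Qed.

Lemma subset_cons X a rs :
  (X \subset a :: rs) = if a \in X then X :\ a \subset rs else X \subset rs.
Proof.
apply/subsetP/idP => [h | ].
  case: ifP => aX; apply/subsetP => r; last first.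
    by move=> rX; have := h r rX; rewrite inE; case: eqP => // e; rewrite -e rX in aX.
  by rewrite !inE => /andP[ne /h]; rewrite inE (negPf ne).
case: ifP => _ /subsetP h r rX; rewrite inE; last by rewrite h ?orbT.
by case: (eqVneq r a) => //= ne; apply: h; rewrite !inE ne.
Qed.

(** A cell is a set of [i] variables; those of [X] are forced, the others are chosen from [l]. The
    guard [#|X| <= i] is there because subtraction is truncated. *)
Lemma count_subset_cells rs l i X : uniq rs ->
  count (xsupport X) (subset_cells (colon_vars rs l) i) =
  if (X \subset rs) && (#|X| <= i)%N then 'C(size l, i - #|X|) else 0%N.
Proof.
elim: rs i X => [|a rs IHrs] i X /=.
  move=> _; have -> : (X \subset [::]) = (X == set0).
    by rewrite -subset0; apply: eq_subset_r => r; rewrite inE.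
  rewrite -(size_map (@rshift n m)) -size_subset_cells.
  rewrite (eq_in_count (a2 := fun=> X == set0)) => [|mon].
    case: eqVneq => [-> | _] /=; last exact: count_pred0.
    by rewrite cards0 subn0 count_predT.
  move=> monP; rewrite -xsupport0; apply: eq_forallb => r; rewrite mnm0E.
  congr (_ == _); apply/eqP; rewrite eqn0Ngt; apply/negP => /(supp_subset_cells monP).
  by rewrite /colon_vars /= => /mapP[c _ /eqP]; rewrite eq_lrshift.
move=> /andP[ars urs]; case: i => [|i].
  rewrite /= addn0 xsupport0 leqn0 cards_eq0 andbC; case: eqVneq => [-> | _] //=.
  by rewrite (_ : _ \subset _) ?sub0n ?bin0 //; apply/subsetP => r; rewrite inE.
rewrite /= count_cat count_map IHrs //.
under [X in (_ + X)%N]eq_count => mon.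
  rewrite /= (@xsupport_add X mon _ a); last first.
    by move=> r; rewrite mnmDE mnm1E eq_lshift.
  over.
rewrite subset_cons; case: (boolP (a \in X)) => aX.
  have -> : X \subset rs = false.
    by apply/negP => /subsetP/(_ _ aX); rewrite (negPf ars).
  rewrite /= add0n (eq_count (a2 := xsupport (X :\ a))) // IHrs //.
  by rewrite (cardsD1 a X) aX add1n ltnS subSS.
by rewrite [X in (_ + X)%N](eq_count (a2 := pred0)) // count_pred0 addn0.
Qed.

(** The multidegrees supported on [s] rows and on [i + 2 - s] of the [q] columns of
    the smallest of these rows; at least one column must be present. *)
Definition nested_betti s q i := if (s <= i.+1)%N then 'C(q, i.+2 - s) else 0%N.

Variable ys : 'I_n -> seq 'I_m.
Hypothesis ys_uniq : forall a, uniq (ys a).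

(** Each column adjoined contributes a binomial coefficient, and Pascal's rule adds them up. *)
Lemma count_row_cells a rs l i base X : uniq rs ->
  count (xsupport X) (row_cells a rs l i base) =
  (count (xsupport X) base +
   if (a \in X) && (X :\ a \subset rs) then nested_betti #|X| (size l) i else 0)%N.
Proof.
move=> urs; elim: l => [|b l IHl] /=.
  (* Under the guard [i.+2 - #|X|] is positive, so without columns the binomial coefficient
     vanishes. *)
  rewrite /nested_betti /= (_ : (if _ then _ else _) = 0%N) ?addn0 //.
  by case: ifP => // _; case: leqP => // le; rewrite subSn.
rewrite count_cat IHl count_map -addnA; congr (_ + _)%N.
rewrite (eq_count (a2 := fun mon => (a \in X) && xsupport (X :\ a) mon)); last first.
  by move=> mon /=; apply: xsupport_add => r; apply: edge_monDx.
case: (boolP (a \in X)) => aX /=; last by rewrite count_pred0.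
rewrite (eq_count (a2 := xsupport (X :\ a))) // count_subset_cells //.
case: (X :\ a \subset rs) => //=; rewrite (cardsD1 a X) aX /nested_betti add1n ltnS subSS.
by case: leqP => // le; rewrite subSn // binS.
Qed.

Lemma count_nested_cells0 rs i : uniq rs ->
  count (xsupport set0) (nested_cells ys rs i) = 0%N.
Proof.
elim: rs => //= a rs IHrs /andP[_ urs].
by rewrite count_row_cells // IHrs // inE.
Qed.

(** Only the first row of [rs] that lies in [X] contributes: cells of earlier rows involve an [x_a]
    outside [X], and cells of later rows miss this one. *)
Lemma count_nested_cells rs i X r0 : uniq rs -> nested ys rs ->
  X \subset rs -> r0 \in X ->
  (forall r, r \in X -> (size (ys r0) <= size (ys r))%N) ->
  count (xsupport X) (nested_cells ys rs i) = nested_betti #|X| (size (ys r0)) i.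
Proof.
move=> + + + r0X min; rewrite /nested; elim: rs => [_ _ /subsetP/(_ _ r0X)//|a rs IHrs /=].
move=> /andP[ars urs] /andP[/allP nest_a nest] sub.
rewrite count_row_cells //; rewrite subset_cons in sub; case: (boolP (a \in X)) sub => /= aX sub.
  rewrite sub (_ : count _ _ = 0%N) ?add0n; last first.
    apply/eqP; rewrite -leqn0 leqNgt -has_count; apply/hasPn => mon monP.
    apply/negP => /forallP/(_ a); rewrite aX => /eqP xa.
    by move: ars; rewrite (supp_nested_cells_rows (r := a) monP) ?xa.
  (* By nesting row [a] is contained in row [r0], which is smallest; so they have the same size. *)
  congr nested_betti; apply/eqP; rewrite eqn_leq min // andbT.
  case: (eqVneq r0 a) => [-> // | ne]; apply: uniq_leq_size => // c.
  by apply/allP/nest_a; apply: (subsetP sub); rewrite !inE ne.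
by rewrite addn0 IHrs.
Qed.

End Counting.

(** * Regrading and specialization *)

Section Regrading.
Variables (k : fieldType) (A A' : zmodType) (N : nat).
Variables (w : 'I_N -> A) (w' : 'I_N -> A') (f : A -> A').
Hypothesis f_sub : forall a b, f (a - b) = f a - f b.
Hypothesis f_wdeg : forall mon, f (wdeg w mon) = wdeg w' mon.

Lemma homogeneous_regrade a (p : {mpoly k[N]}) :
  homogeneous w a p -> homogeneous w' (f a) p.
Proof. by move=> hp mon /hp <-. Qed.

Variables (K : {mpoly k[N]} -> Prop) (F : graded_free_resolution w K).

Lemma regrade_aug_subproof b : homogeneous w' (f (bdeg b)) (aug F b 0).
Proof. exact/homogeneous_regrade/aug_homogeneous. Qed.

Lemma regrade_diff_subproof i (b : 'I_(frank F i.+1)) (b' : 'I_(frank F i)) :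
  homogeneous w' (f (bdeg b) - f (bdeg b')) (fdiff F i b b').
Proof. by rewrite -f_sub; exact/homogeneous_regrade/fdiff_homogeneous. Qed.

(** The fine grading determines the shape of the differential, the coarse one defines the Betti
    number; this allows both on one complex. *)
Definition regrade : graded_free_resolution w' K :=
  GradedFreeResolution regrade_aug_subproof regrade_diff_subproof
    (@aug_image _ _ _ _ _ F) (@aug_exact _ _ _ _ _ F) (@fdiff_exact _ _ _ _ _ F).

End Regrading.

Section Specializations.
Variables (k : fieldType) (N : nat).

Lemma mpoly_rmorph_ext (R : comNzRingType) (f g : {rmorphism {mpoly k[N]} -> R}) :
  (forall c, f c%:MP = g c%:MP) -> (forall v, f 'X_v = g 'X_v) -> f =1 g.
Proof.
move=> fgC fgX p; rewrite [p]mpolyE !rmorph_sum; apply: eq_bigr => mon _ /=.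
rewrite -mul_mpolyC !rmorphM fgC mpolyXE_id !rmorph_prod; congr (_ * _).
by apply: eq_bigr => v _; rewrite !rmorphXn fgX.
Qed.

Lemma mmap1_eq0 (R : comNzRingType) (h : 'I_N -> R) (mon : 'X_{1..N}) v :
  h v = 0 -> (0 < mon v)%N -> mmap1 h mon = 0.
Proof.
move=> hv0 mon_v; rewrite /mmap1 (bigD1 v) //= hv0 expr0n.
by rewrite eqn0Ngt mon_v mul0r.
Qed.

Lemma mmap_eq0 (R : comNzRingType) (f : {rmorphism k -> R}) (h : 'I_N -> R)
    (p : {mpoly k[N]}) :
  (forall mon, mon \in msupp p -> exists2 v, h v = 0 & (0 < mon v)%N) ->
  mmap f h p = 0.
Proof.
move=> h0; rewrite /mmap big1_seq // => mon /andP[_ /h0[v hv mon_v]].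
by rewrite (mmap1_eq0 hv mon_v) mulr0.
Qed.

(** Sets the variables outside [S] to zero, as an endomorphism, so that gradings and matrices keep
    their types. *)
Definition kill (S : pred 'I_N) : {mpoly k[N]} -> {mpoly k[N]} :=
  mmap (@mpolyC N k) (fun v => if S v then 'X_v else 0).
HB.instance Definition _ (S : pred 'I_N) :=
  GRing.RMorphism.copy (kill S) (mmap (@mpolyC N k) (fun v => if S v then 'X_v else 0)).

Lemma killX (S : pred 'I_N) v : kill S 'X_v = if S v then 'X_v else 0.
Proof. by rewrite /kill mmapX mmap1U. Qed.

Lemma kill_id (S : pred 'I_N) (p : {mpoly k[N]}) :
  (forall mon v, mon \in msupp p -> (0 < mon v)%N -> S v) -> kill S p = p.
Proof.
move=> pS; rewrite /kill /mmap [RHS]mpolyE; apply: eq_big_seq => mon p_mon.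
rewrite mul_mpolyC; congr (_ *: _); rewrite mpolyXE_id; apply: eq_bigr => v _.
have [-> | mon_v] := posnP (mon v); first by rewrite !expr0.
by rewrite (pS mon).
Qed.

Lemma homogeneous_kill (A : zmodType) (w : 'I_N -> A) (S : pred 'I_N) a
    (p : {mpoly k[N]}) :
  homogeneous w a p -> homogeneous w a (kill S p).
Proof.
move=> hp; rewrite /kill /mmap big_seq; apply: homogeneous_sum => mon /hp <-.
rewrite -[wdeg w mon]add0r; apply: homogeneousM.
  by rewrite -(wdeg0 w) => m' /=; rewrite msuppC; case: ifP => // _; rewrite inE => /eqP ->.
case: (boolP [forall v, (0 < mon v)%N ==> S v]) => [/forallP monS | ].
  suff -> : mmap1 (fun v => if S v then 'X_v else 0) mon = 'X_[k, mon] by apply: homogeneousX.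
  rewrite mpolyXE_id; apply: eq_bigr => v _.
  have [-> | mon_v] := posnP (mon v); first by rewrite !expr0.
  by have := monS v; rewrite mon_v /= => ->.
rewrite negb_forall => /existsP[v]; rewrite negb_imply => /andP[mon_v Sv].
rewrite (@mmap1_eq0 _ _ mon v) //; first exact: homogeneous0.
by rewrite (negPf Sv).
Qed.

End Specializations.

Lemma horner_polyC_mx (k : fieldType) p q (M : 'M[k]_(p, q)) :
  map_mx (horner_eval 0) (map_mx polyC M) = M.
Proof. by apply/matrixP => i j; rewrite !mxE /horner_eval hornerC. Qed.

(** Constant matrices [L] and [R] reduce the value of [M] at 0 to an identity matrix. Applied to [M]
    itself they give a square matrix whose determinant is 1 at 0, hence a nonzero polynomial. *)
Lemma rank_horner_le_tofrac (k : fieldType) p q (M : 'M[{poly k}]_(p, q)) :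
  (\rank (map_mx (horner_eval 0) M) <= \rank (map_mx (@tofrac {poly k}) M))%N.
Proof.
set M0 := map_mx _ M.
have /row_fullP[L LM] := col_base_full M0; have /row_freeP[R RM] := row_base_free M0.
have e1 : L *m M0 *m R = 1%:M.
  by rewrite -[X in L *m X]mulmx_base mulmxA LM mul1mx.
pose Q := map_mx polyC L *m M *m map_mx polyC R.
have detQ : \det Q != 0.
  apply/eqP => detQ0; have : horner_eval 0 (\det Q) = 1.
    rewrite -det_map_mx map_mxM map_mxM.
    by rewrite [X in X *m _ *m _]horner_polyC_mx [X in _ *m X]horner_polyC_mx e1 det1.
  by rewrite detQ0 rmorph0 => /esym/eqP; rewrite oner_eq0.
have : map_mx (@tofrac {poly k}) Q \in unitmx.
  by rewrite unitmxE det_map_mx unitfE tofrac_eq0.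
move=> /mxrank_unit rQ; rewrite -[leqLHS]rQ map_mxM map_mxM.
exact: leq_trans (mxrankM_maxl _ _) (mxrankM_maxr _ _).
Qed.

(** * Multidegrees and the entries of the differential *)

Section Cells.
Variables (k : fieldType) (N : nat).

Lemma card_bdeg (A : zmodType) (w : 'I_N -> A) (K : {mpoly k[N]} -> Prop)
    (F : graded_free_resolution w K) (c : seq 'X_{1..N}) i a :
  [seq bdeg b | b : 'I_(frank F i)] = map (wdeg w) c ->
  #|[pred b : 'I_(frank F i) | bdeg b == a]| = count (fun mon => wdeg w mon == a) c.
Proof.
move=> eF; rewrite -(count_map (wdeg w) (pred1 a)) -eF count_map.
by rewrite cardE -size_filter enumT /enum_mem -enumT.
Qed.

Lemma wdeg_unit_deg (mon : 'X_{1..N}) v : wdeg (@unit_deg N) mon v = (mon v)%:Z.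
Proof.
rewrite /wdeg sum_ffunE (bigD1 v) //= big1 ?addr0 => [|v' ne].
  by rewrite ffunMnE ffunE eqxx; rewrite -natz.
by rewrite ffunMnE ffunE eq_sym (negPf ne) mul0rn.
Qed.

(** A fine degree is an exponent vector, so a monomial in an entry is the quotient of the
    multidegrees of the two cells. *)
Lemma fine_diff (K : {mpoly k[N]} -> Prop)
    (F : graded_free_resolution (@unit_deg N) K) cs i
    (b : 'I_(frank F i.+1)) (b' : 'I_(frank F i)) mon :
  (forall j, [seq bdeg b | b : 'I_(frank F j)] = map (wdeg (@unit_deg N)) (cs j)) ->
  mon \in msupp (fdiff F i b b') ->
  exists mb mb', [/\ mb \in cs i.+1, mb' \in cs i,
    bdeg b = wdeg (@unit_deg N) mb & mb = (mon + mb')%MM].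
Proof.
move=> eF /fdiff_homogeneous mon_deg.
have /mapP[mb mbP eb] : bdeg b \in map (wdeg (@unit_deg N)) (cs i.+1).
  by rewrite -eF; apply: image_f.
have /mapP[mb' mbP' eb'] : bdeg b' \in map (wdeg (@unit_deg N)) (cs i).
  by rewrite -eF; apply: image_f.
exists mb, mb'; split=> //; apply/mnmP => v; apply/eqP.
rewrite -eqz_nat -!wdeg_unit_deg wdegD mon_deg eb eb' subrK.
exact: eqxx.
Qed.

Lemma fine_aug (K : {mpoly k[N]} -> Prop)
    (F : graded_free_resolution (@unit_deg N) K) cs (b : 'I_(frank F 0)) mon :
  (forall j, [seq bdeg b | b : 'I_(frank F j)] = map (wdeg (@unit_deg N)) (cs j)) ->
  mon \in msupp (aug F b 0) -> mon \in cs 0%N.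
Proof.
move=> eF /aug_homogeneous mon_deg.
have /mapP[mb mbP eb] : bdeg b \in map (wdeg (@unit_deg N)) (cs 0%N).
  by rewrite -eF; apply: image_f.
suff -> : mon = mb by [].
apply/mnmP => v; apply/eqP.
by rewrite -eqz_nat -!wdeg_unit_deg mon_deg eb.
Qed.

End Cells.

(** * The grading by the x-variables *)

Section XGrading.
Variables (n m : nat).

Definition xproj (g : {ffun 'I_(n + m) -> int}) : {ffun 'I_n -> int} :=
  [ffun r => g (lshift m r)].

Lemma xproj_sub g g' : xproj (g - g') = xproj g - xproj g'.
Proof. by apply/ffunP => r; rewrite !ffunE. Qed.

Lemma wdeg_xgradingE (mon : 'X_{1..n + m}) r :
  wdeg (@xgrading n m) mon r = (mon (lshift m r))%:Z.
Proof.
rewrite /wdeg sum_ffunE (bigD1 (lshift m r)) //= big1 ?addr0 => [|v ne].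
  by rewrite ffunMnE /xgrading (unsplitK (inl _)) ffunE eqxx -natz.
rewrite ffunMnE /xgrading; case: splitP ne => [l vE ne | l vE _].
  rewrite ffunE; case: eqVneq => [rl | _]; last by rewrite mul0rn.
  by case/eqP: ne; apply: val_inj; rewrite /= vE rl.
by rewrite ffunE mul0rn.
Qed.

Lemma xproj_wdeg mon : xproj (wdeg (@unit_deg (n + m)) mon) = wdeg (@xgrading n m) mon.
Proof. by apply/ffunP => r; rewrite ffunE wdeg_unit_deg wdeg_xgradingE. Qed.

Lemma xsupportE (X : {set 'I_n}) (mon : 'X_{1..n + m}) :
  (wdeg (@xgrading n m) mon == \sum_(l in X) unit_deg l) = xsupport X mon.
Proof.
have XE r : (\sum_(l in X) unit_deg l) r = ((r \in X) : nat)%:Z :> int.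
  rewrite sum_ffunE; case: (boolP (r \in X)) => rX.
    rewrite (bigD1 r) //= ffunE eqxx big1 ?addr0 ?natz // => l /andP[_ ne].
    by rewrite ffunE eq_sym (negPf ne).
  rewrite big1 // => l lX; rewrite ffunE; case: eqVneq => // rl.
  by rewrite rl lX in rX.
apply/eqP/forallP => [e r | h].
  by rewrite -eqz_nat -XE -e wdeg_xgradingE.
by apply/ffunP => r; rewrite wdeg_xgradingE (eqP (h r)) XE.
Qed.

Lemma nested_sort (ys : 'I_n -> seq 'I_m) s :
  total (fun a a' => all (mem (ys a')) (ys a)) -> uniq s ->
  exists rs, [/\ uniq rs, nested ys rs & rs =i s].
Proof.
move=> tot us; exists (sort (fun a a' => all (mem (ys a')) (ys a)) s).
split; [by rewrite sort_uniq | | exact: mem_sort].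
rewrite /nested -sorted_pairwise; first exact: sort_sorted.
move=> a b c /allP ba /allP ac; apply/allP => j /ba; exact: ac.
Qed.

End XGrading.

(** * The upper bound for the ideal of the degree graph *)

Section TorBounds.
Variables (k : fieldType) (n m : nat).
Variables (X : {set 'I_n}) (i : nat).
Let deg_X : {ffun 'I_n -> int} := \sum_(l in X) unit_deg l.

Lemma mcoeff0_homogeneous (A : zmodType) N (w : 'I_N -> A) a (p : {mpoly k[N]}) :
  a != 0 -> homogeneous w a p -> mcoeff 0%MM p = 0.
Proof.
move=> a0 /homogeneous_mcoeffP; apply; by rewrite wdeg0 eq_sym.
Qed.

Lemma tor_dimE (A : zmodType) N (w : 'I_N -> A) (K : {mpoly k[N]} -> Prop)
    (F : graded_free_resolution w K) a :
  tor_dim F i a =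
  (\rank (spec_cycles (mcoeff 0%MM) (of_resolution F) i a)
   - \rank (spec_boundaries (mcoeff 0%MM) (of_resolution F) i a))%N.
Proof. by case: i. Qed.

(** Comparison maps in both directions compose to a lift of the identity: [retract_rank] with
    [u = 1]. *)
Lemma tor_dim_le (A : zmodType) N (w : 'I_N -> A) (K : {mpoly k[N]} -> Prop)
    (F L : graded_free_resolution w K) a :
  (tor_dim F i a <= #|[pred b : 'I_(frank L i) | bdeg b == a]|)%N.
Proof.
have img (R : graded_free_resolution w K) b : K (aug R b 0).
  by apply/(aug_image R); exists (delta_mx 0 b); rewrite -rowE mxE.
have [al hal al0] := @lifting _ _ _ _ (of_resolution F) _ L (img F).
have [be hbe be0] := @lifting _ _ _ _ (of_resolution L) _ F (img L).
rewrite tor_dimE; apply: leq_trans (@retract_rank _ _ _ _ _ (mcoeff 0%MM)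
  (@mcoeff0_homogeneous _ _ w) _ F (of_resolution L) 1 al be i a hal hbe _ _ _) _.
- exact: homogeneous1.
- by rewrite rmorph1 oner_eq0.
- by rewrite -mulmxA be0 al0 scale1r.
apply: leq_trans (leq_subr _ _) _.
by rewrite -(@rank_spec_part _ _ _ w k (of_resolution L)); apply/mxrankS/spec_cycles_part.
Qed.

Definition degree_rows (G : bigraph n m) a := [seq j : 'I_m <- enum 'I_m | (j < xdegree G a)%N].

Lemma size_degree_rows G a : size (degree_rows G a) = xdegree G a.
Proof.
rewrite size_filter -(count_map (@nat_of_ord m) (fun j => j < xdegree G a)%N) val_enum_ord.
have le : (xdegree G a <= m)%N by rewrite -[m in leqRHS]card_ord max_card.
rewrite -[X in iota 0 X](subnKC le) iotaD count_cat add0n.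
rewrite (@eq_in_count _ _ predT (iota 0 _)) => [|j]; last by rewrite mem_iota /= add0n => ->.
rewrite count_predT size_iota (@eq_in_count _ _ pred0) ?count_pred0 ?addn0 // => j.
by rewrite mem_iota => /andP[le_j _] /=; rewrite ltnNge le_j.
Qed.

(** The rows of the degree graph are initial segments, so sorting them by inclusion makes them
    nested. *)
Lemma degree_graph_resolved (G : bigraph n m) :
  exists rs, [/\ uniq rs, nested (degree_rows G) rs, rs =i 'I_n &
    resolved (@xgrading n m) (@edge_ideal k n m (degree_graph G))
      (nested_cells (degree_rows G) rs)].
Proof.
have [|rs [urs nest rsE]] := @nested_sort n m (degree_rows G) _ _ (enum_uniq 'I_n).
  move=> a a'; apply/orP; have [le | /ltnW le] := leqP (xdegree G a) (xdegree G a').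
    left; apply/allP => j; rewrite /= !mem_filter => /andP[lt ->].
    by rewrite (leq_trans lt le).
  right; apply/allP => j; rewrite /= !mem_filter => /andP[lt ->].
  by rewrite (leq_trans lt le).
exists rs; split=> // [a | ]; first by rewrite rsE mem_enum.
apply: resolved_iff (@resolved_nested k n m _ _ _ (@xgrading n m) rs urs nest).
  move=> p; apply: iff_sym; apply: edge_idealP => mon.
  apply: (iffP (nested_gensP _ _ _)) => -[[a b] /= abP ->]; exists (a, b) => //.
    by move: abP; rewrite mem_filter inE => /and3P[].
  by rewrite inE in abP; rewrite rsE mem_enum mem_filter abP mem_enum.
by move=> a; apply/filter_uniq/enum_uniq.
Qed.

Lemma tor_dim_degree_graph_le (G : bigraph n m) r0
    (F : graded_free_resolution (@xgrading n m) (@edge_ideal k n m (degree_graph G))) :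
  r0 \in X -> (forall r, r \in X -> xdegree G r0 <= xdegree G r)%N ->
  (tor_dim F i deg_X <= nested_betti #|X| (xdegree G r0) i)%N.
Proof.
move=> r0X min; have [rs [urs nest rsE [L eL]]] := degree_graph_resolved G.
apply: leq_trans (tor_dim_le F L deg_X) _.
rewrite (card_bdeg _ (eL i)) (eq_count (@xsupportE n m X)).
rewrite (count_nested_cells _ _ urs nest _ r0X) ?size_degree_rows //.
- by move=> a; apply/filter_uniq/enum_uniq.
- by apply/subsetP => r _; rewrite rsE.
- by move=> r; rewrite !size_degree_rows; apply: min.
Qed.

Lemma tor_dim_degree_graph0 (G : bigraph n m)
    (F : graded_free_resolution (@xgrading n m) (@edge_ideal k n m (degree_graph G))) :
  X = set0 -> tor_dim F i deg_X = 0%N.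
Proof.
move=> X0; have [rs [urs nest rsE [L eL]]] := degree_graph_resolved G.
apply/eqP; rewrite -leqn0; apply: leq_trans (tor_dim_le F L deg_X) _.
by rewrite (card_bdeg _ (eL i)) (eq_count (@xsupportE n m X)) X0 count_nested_cells0.
Qed.

End TorBounds.

(** * Setting variables of a complex to zero *)

Section KillComplex.
Variables (k : fieldType) (A : zmodType) (N : nat) (w : 'I_N -> A).
Variables (S : pred 'I_N) (C : gcomplex k w).

Lemma kill_aug_subproof b : homogeneous w (cdeg b) ((map_mx (kill S) (caug C)) b 0).
Proof. by rewrite mxE; apply/homogeneous_kill/caug_homogeneous. Qed.

Lemma kill_diff_subproof i : homogeneous_mx w (@cdeg _ _ _ _ C i.+1) (@cdeg _ _ _ _ C i)
  (map_mx (kill S) (cdiff C i)).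
Proof. by move=> b b'; rewrite mxE; apply/homogeneous_kill/cdiff_homogeneous. Qed.

Lemma kill_diff_aug_subproof :
  map_mx (kill S) (cdiff C 0) *m map_mx (kill S) (caug C) = 0.
Proof. by rewrite -map_mxM cdiff_aug map_mx0. Qed.

Lemma kill_diff_diff_subproof i :
  map_mx (kill S) (cdiff C i.+1) *m map_mx (kill S) (cdiff C i) = 0.
Proof. by rewrite -map_mxM cdiff_diff map_mx0. Qed.

Definition kill_complex : gcomplex k w :=
  GComplex kill_aug_subproof kill_diff_subproof kill_diff_aug_subproof
    kill_diff_diff_subproof.

Lemma spec_kill_complex (L : fieldType) (e : {rmorphism {mpoly k[N]} -> L}) i a :
  (forall p, e (kill S p) = e p) ->
  spec_cycles e kill_complex i a = spec_cycles e C i a /\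
  spec_boundaries e kill_complex i a = spec_boundaries e C i a.
Proof.
move=> ekill; have eD j : map_mx e (cdiff kill_complex j) = map_mx e (cdiff C j).
  by apply/matrixP => b b'; rewrite !mxE ekill.
by split; rewrite ?/spec_boundaries ?eD //; case: i => //= j; rewrite eD.
Qed.

End KillComplex.

(** * Evaluation at the generic point of a line through the origin *)

Section GenericPoint.
Variables (k : fieldType) (n m : nat) (Y0 : {set 'I_m}).

(** Parametrized by ['X]: at 0 it gives the constant term, while over the fraction field the [y_j]
    outside [Y0] are invertible, also when [k] is finite. *)
Definition curve (v : 'I_(n + m)) : {poly k} :=
  match split v with inl _ => 0 | inr j => if j \in Y0 then 0 else 'X end.

Definition eval_curve : {mpoly k[n + m]} -> {poly k} := mmap (@polyC k) curve.
HB.instance Definition _ :=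
  GRing.RMorphism.copy eval_curve (mmap (@polyC k) curve).

Definition eval_generic : {mpoly k[n + m]} -> {fraction {poly k}} :=
  @tofrac {poly k} \o eval_curve.
HB.instance Definition _ :=
  GRing.RMorphism.copy eval_generic (@tofrac {poly k} \o eval_curve).

Lemma curvex r : curve (lshift m r) = 0.
Proof. by rewrite /curve (unsplitK (inl _)). Qed.

Lemma curvey j : curve (rshift n j) = if j \in Y0 then 0 else 'X.
Proof. by rewrite /curve (unsplitK (inr _)). Qed.

Lemma eval_generic_eq0 (p : {mpoly k[n + m]}) :
  (forall mon, mon \in msupp p -> exists2 v, curve v = 0 & (0 < mon v)%N) ->
  eval_generic p = 0.
Proof. by move=> h; rewrite /eval_generic /= [eval_curve p]mmap_eq0 ?rmorph0. Qed.

(** The condition [eN0]: a monomial of nonzero x-degree contains some [x_r], which vanishes on the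
    line. *)
Lemma eval_generic_homogeneous a (p : {mpoly k[n + m]}) :
  a != 0 -> homogeneous (@xgrading n m) a p -> eval_generic p = 0.
Proof.
move=> a0 hp; apply: eval_generic_eq0 => mon /hp mon_a.
have [r mon_r] : exists r, (0 < mon (lshift m r))%N.
  apply/existsP; apply: contraNT a0; rewrite negb_exists => /forallP mon0.
  apply/eqP/ffunP => r; rewrite -mon_a wdeg_xgradingE ffunE.
  by have := mon0 r; rewrite lt0n negbK => /eqP ->.
by exists (lshift m r); rewrite ?curvex.
Qed.

Lemma horner_eval_curve (p : {mpoly k[n + m]}) :
  horner_eval 0 (eval_curve p) = mcoeff 0%MM p.
Proof.
apply: (@mpoly_rmorph_ext k _ k (horner_eval 0 \o eval_curve) (mcoeff 0%MM)) => [c|v] /=.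
  by rewrite /eval_curve mmapC /horner_eval hornerC mcoeffC eqxx mulr1.
rewrite /eval_curve mmapX mmap1U mcoeffX mnm1_eq0 /horner_eval.
have [r ->|j ->] := split_ordP v; first by rewrite curvex hornerC.
by rewrite curvey; case: ifP; rewrite ?hornerC ?hornerX.
Qed.

Lemma eval_generic_kill (S : pred 'I_(n + m)) (p : {mpoly k[n + m]}) :
  (forall v, ~~ S v -> curve v = 0) -> eval_generic (kill S p) = eval_generic p.
Proof.
move=> S0; rewrite /eval_generic /=; congr tofrac.
apply: (@mpoly_rmorph_ext k _ _ (eval_curve \o kill S) eval_curve) => [c|v] /=.
  by rewrite /kill mmapC.
rewrite killX; case: ifPn => // /S0 v0.
by rewrite rmorph0 /eval_curve mmapX mmap1U.
Qed.

(** Semicontinuity: the ranks of the differentials can only drop at [t = 0]. *)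
Lemma spec_generic_le (K : {mpoly k[n + m]} -> Prop)
    (F : graded_free_resolution (@xgrading n m) K) i a :
  (\rank (spec_cycles eval_generic (of_resolution F) i a)
   - \rank (spec_boundaries eval_generic (of_resolution F) i a) <= tor_dim F i a)%N.
Proof.
have rank_le j : (\rank (spec_boundaries (mcoeff 0%MM) (of_resolution F) j a)
   <= \rank (spec_boundaries eval_generic (of_resolution F) j a))%N.
  pose P : 'M[{poly k}]_(frank F j.+1) := diag_mx (\row_b (bdeg b == a)%:R).
  have := rank_horner_le_tofrac (P *m map_mx eval_curve (fdiff F j)).
  suff [-> ->] : map_mx (horner_eval 0) (P *m map_mx eval_curve (fdiff F j)) =
      spec_boundaries (mcoeff 0%MM) (of_resolution F) j a /\
      map_mx (@tofrac _) (P *m map_mx eval_curve (fdiff F j)) =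
      spec_boundaries eval_generic (of_resolution F) j a by [].
  rewrite /spec_boundaries /spec_part !mul_diag_mx.
  split; apply/matrixP => b b'; rewrite !mxE rmorphM rmorph_nat //.
  by congr (_ * _); apply: horner_eval_curve.
rewrite tor_dimE; apply: leq_sub; last exact: rank_le.
have rkP (L : fieldType) j : \rank (spec_part L (of_resolution F) j a) =
    #|[pred b : 'I_(frank F j) | bdeg b == a]| by apply: rank_spec_part.
case: i => [|i] /=; first by rewrite !rkP.
(* The degree [a] part has the same dimension over both fields; by rank-nullity the cycles grow as
   the rank of the outgoing differential drops. *)
have := mxrank_mul_ker (spec_part {fraction {poly k}} (of_resolution F) i.+1 a)
  (map_mx eval_generic (fdiff F i)).
have := mxrank_mul_ker (spec_part k (of_resolution F) i.+1 a)
  (map_mx (mcoeff 0%MM) (fdiff F i)).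
rewrite !rkP => <- eq_sum.
by rewrite -(leq_add2l (\rank (spec_boundaries (mcoeff 0%MM) (of_resolution F) i a)))
  -[leqRHS]eq_sum leq_add2r.
Qed.

End GenericPoint.

(** * Comparison with the localized ideal *)

Lemma edge_mon_enumP n m (G : bigraph n m) mon :
  reflect (exists2 e, e \in G & mon = edge_mon e.1 e.2)
          (mon \in [seq edge_mon e.1 e.2 | e <- enum G]).
Proof.
by apply: (iffP mapP) => -[e]; rewrite ?mem_enum => eG ->; exists e; rewrite ?mem_enum.
Qed.

Section LowerBound.
Variables (k : fieldType) (n m : nat) (G : bigraph n m).
Variables (X : {set 'I_n}) (r0 : 'I_n) (i : nat).
Hypothesis r0X : r0 \in X.
Hypothesis r0_min : forall r, r \in X -> (xdegree G r0 <= xdegree G r)%N.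

Let nbr r := [set j | (r, j) \in G].
Let Y0 := nbr r0.
Let deg_X : {ffun 'I_n -> int} := \sum_(l in X) unit_deg l.

(** If [x_r] has a neighbour outside [Y0], then [x_r] is in the edge ideal as soon
    as the [y_j] outside [Y0] are invertible. Giving it all of [Y] as its row
    makes the rows nested, and has the same effect after this localization. *)
Definition saturated_rows r := enum (if nbr r \subset Y0 then Y0 else [set: 'I_m]).

(** The exponent of the product of the [y_j] outside [Y0], the monomial that is inverted. *)
Let away : 'X_{1..n + m} :=
  [multinom match split v with inl _ => 0%N | inr j => nat_of_bool (j \notin Y0) end
   | v < n + m].

Lemma awayx r : away (lshift m r) = 0%N.
Proof. by rewrite mnmE (unsplitK (inl _)). Qed.

Lemma awayy j : away (rshift n j) = (j \notin Y0).
Proof. by rewrite mnmE (unsplitK (inr _)). Qed.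

Let S : pred 'I_(n + m) :=
  fun v => match split v with inl r => r \in X | inr _ => true end.

Lemma Sx r : S (lshift m r) = (r \in X).
Proof. by rewrite /S (unsplitK (inl _)). Qed.

Lemma Sy j : S (rshift n j).
Proof. by rewrite /S (unsplitK (inr _)). Qed.

Lemma saturated_rows_total :
  total (fun a a' => all (mem (saturated_rows a')) (saturated_rows a)).
Proof.
move=> a a'; rewrite /saturated_rows; case: (boolP (nbr a' \subset Y0)) => _.
  by apply/orP; right; apply/allP => j; rewrite /= !mem_enum; case: ifP; rewrite ?inE.
by apply/orP; left; apply/allP => j _; rewrite /= mem_enum inE.
Qed.

(** Let [a] be a row in [X]. If its neighbourhood lies in [Y0], minimality of the degree of [r0]
    makes it equal to [Y0], so the edge is in [G]. Otherwise [x_a] has a neighbour [c] outside [Y0],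
    and [y_c] divides the monomial [away]. *)
Lemma saturated_ideal_away rs mon : rs =i X ->
  divisible (nested_gens saturated_rows rs) mon ->
  divisible [seq edge_mon e.1 e.2 | e <- enum G] (away + mon)%MM.
Proof.
move=> rsE /hasP[_ /nested_gensP[[a b] /= /andP[aX ab] ->]].
rewrite edge_mon_le => /andP[xa yb]; rewrite rsE in aX.
suff [c Gac yc] : exists2 c, (a, c) \in G & (0 < (away + mon)%MM (rshift n c))%N.
  apply/hasP; exists (edge_mon a c); first by apply/mapP; exists (a, c); rewrite ?mem_enum.
  by rewrite edge_mon_le yc mnmDE awayx xa.
move: ab; rewrite mem_enum; case: ifPn => [sub bY0 | /subsetPn[c Nc Y0c] _].
  exists b; last by rewrite mnmDE ltn_addl.
  have /eqP NaE : nbr a == Y0 by rewrite eqEcard sub; apply: r0_min.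
  by move: bY0; rewrite -NaE inE.
by exists c; [rewrite inE in Nc | rewrite mnmDE awayy Y0c].
Qed.

(** Every neighbourhood is contained in its saturated row, so only the edges at [x_r] outside [X]
    could leave the ideal, and these are set to zero. *)
Lemma kill_edge_ideal rs (p : {mpoly k[n + m]}) : rs =i X ->
  edge_ideal G p -> monomial_ideal (nested_gens saturated_rows rs) (kill S p).
Proof.
move=> rsE [c ->]; rewrite rmorph_sum; apply: monomial_ideal_sum => -[a b] Gab.
rewrite !rmorphM /= /xvar /yvar !killX Sx Sy; apply: monomial_idealM.
case: ifP => aX; last by rewrite mul0r => mon; rewrite msupp0.
rewrite [_ * _]edge_monX; apply/monomial_idealX/hasP; exists (edge_mon a b).
  apply/nested_gensP; exists (a, b); rewrite //= rsE aX mem_enum /=.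
  case: ifP => [/subsetP sub | _]; last by rewrite inE.
  by apply: sub; rewrite inE.
exact: lepm_refl.
Qed.

Lemma nested_betti_le_tor_dim
    (F : graded_free_resolution (@xgrading n m) (@edge_ideal k n m G)) :
  (nested_betti #|X| (xdegree G r0) i <= tor_dim F i deg_X)%N.
Proof.
have [rs [urs nest rsE]] := nested_sort saturated_rows_total (enum_uniq X).
have {}rsE : rs =i X by move=> r; rewrite rsE mem_enum.
have urows a : uniq (saturated_rows a) by apply: enum_uniq.
have rows_r0 : saturated_rows r0 = enum Y0 by rewrite /saturated_rows subxx.
have [L0 eL0] :=
  @resolved_nested k n m saturated_rows urows _ (@unit_deg (n + m)) rs urs nest.
pose L := regrade (@xproj_sub n m) (@xproj_wdeg n m) L0.
have eL j : [seq bdeg b | b : 'I_(frank L j)] =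
    map (wdeg (@xgrading n m)) (nested_cells saturated_rows rs j).
  transitivity (map (@xproj n m) [seq bdeg b | b : 'I_(frank L0 j)]).
    by rewrite /image_mem -[RHS]map_comp.
  by rewrite eL0 -map_comp; apply: eq_map => mon /=; rewrite xproj_wdeg.
have supp_S j mon v : mon \in nested_cells saturated_rows rs j -> (0 < mon v)%N -> S v.
  have [r ->|c ->] := split_ordP v => monP; last by rewrite Sy.
  by move=> /(supp_nested_cells_rows monP); rewrite rsE Sx.
(* The cells involve only the rows of [X], so setting the other [x_r] to zero does not change
   [L]. *)
have killL j : map_mx (kill S) (fdiff L j) = fdiff L j.
  apply/matrixP => b b'; rewrite mxE; apply: kill_id => mon v mon_d mon_v.
  have [mb [mb' [mbP _ _ eb]]] := fine_diff eL0 mon_d.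
  by apply: (supp_S _ _ _ mbP); rewrite eb mnmDE ltn_addr.
have killaug : map_mx (kill S) (aug L) = aug L.
  apply/matrixP => b b'; rewrite mxE ord1; apply: kill_id => mon v mon_a.
  exact: supp_S (fine_aug eL0 mon_a).
pose u : {mpoly k[n + m]} := 'X_[away].
have hu : homogeneous (@xgrading n m) 0 u.
  suff -> : 0 = wdeg (@xgrading n m) away by apply: homogeneousX.
  by apply/ffunP => r; rewrite wdeg_xgradingE awayx ffunE.
have killu : kill S u = u.
  apply: kill_id => mon v; rewrite msuppX inE => /eqP ->.
  by have [r ->|c ->] := split_ordP v; rewrite ?Sy // awayx.
have huaug b : homogeneous (@xgrading n m) (bdeg b) ((u *: aug L) b 0).
  by rewrite mxE -[bdeg b]add0r; apply/homogeneousM/aug_homogeneous.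
have uaug0 : fdiff L 0 *m (u *: aug L) = 0 by rewrite -scalemxAr fdiff_aug scaler0.
(* With its augmentation multiplied by [u], [L] maps into the edge ideal of [G] and lifts to [F]. *)
pose uL := GComplex huaug (@fdiff_homogeneous _ _ _ _ _ L) uaug0 (fdiff_diff L).
have edge_G (p : {mpoly k[n + m]}) :
    edge_ideal G p <-> monomial_ideal [seq edge_mon e.1 e.2 | e <- enum G] p.
  by apply: edge_idealP => mon; apply: edge_mon_enumP.
have [|psi [hpsi psiS] psi0] := @lifting _ _ _ _ uL _ F.
  move=> b; apply/edge_G; rewrite mxE mulrC => mon.
  rewrite (perm_mem (msuppMX _ _)) => /mapP[mon' mon'P ->].
  apply: saturated_ideal_away rsE _; move: mon' mon'P; apply/(aug_image L).
  by exists (delta_mx 0 b); rewrite -rowE mxE.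
pose D := kill_complex S (of_resolution F).
have [|phi hphi phi0] := @lifting _ _ _ _ D _ L.
  move=> b; rewrite mxE; apply: kill_edge_ideal => //; apply/(aug_image F).
  by exists (delta_mx 0 b); rewrite -rowE mxE.
pose al j := map_mx (kill S) (psi j).
have hal : @chain_map _ _ _ _ (of_resolution L) D al.
  split=> j; first by move=> b b'; rewrite mxE; apply/homogeneous_kill/hpsi.
  by rewrite -map_mxM psiS map_mxM killL.
have eu : eval_generic Y0 u != 0.
  rewrite /eval_generic /= tofrac_eq0 /eval_curve mmapX; apply/prodf_neq0 => v _.
  have [r ->|c ->] := split_ordP v; first by rewrite awayx expr0 oner_neq0.
  rewrite awayy curvey; case: (c \in Y0); first by rewrite expr0 oner_neq0.
  by rewrite expr1 polyX_eq0.
have aug_u : al 0%N *m phi 0%N *m aug L = u *: aug L.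
  by rewrite -mulmxA phi0 -map_mxM psi0 map_mxZ -[in RHS]killu -[in RHS]killaug.
have := @retract_rank _ _ _ _ _ (@eval_generic k n m Y0) (@eval_generic_homogeneous k n m Y0)
  _ L D u al phi i deg_X hal hphi hu eu aug_u.
(* Evaluation already sends every [x_r] to zero, so [D] and [F] have the same specialization. *)
have [|-> ->] := @spec_kill_complex _ _ _ _ S (of_resolution F) _ (@eval_generic k n m Y0) i deg_X.
  move=> p; apply: eval_generic_kill => v.
  by have [r ->|c ->] := split_ordP v; rewrite ?Sy // curvex.
move=> /leq_trans/(_ (spec_generic_le _ _ _ _)); apply: leq_trans.
(* A monomial of the entry is a single variable. If it is [y_c], the cell also involves [x_r0], as
   [r0] is in [X], so [c] lies in the row [Y0] of [r0]; either way the variable vanishes on the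
   line. *)
have bnd0 j : spec_boundaries (@eval_generic k n m Y0) (of_resolution L) j deg_X = 0.
  rewrite /spec_boundaries /spec_part mul_diag_mx; apply/matrixP => b b'; rewrite !mxE.
  case: eqP => [b_deg | _]; last by rewrite mul0r.
  rewrite [X in _ * X](_ : _ = 0) ?mulr0 //.
  apply: eval_generic_eq0 => mon mon_d.
  have [mb [mb' [mbP mbP' b_mb eb]]] := fine_diff eL0 mon_d.
  have /mdeg1P[v /eqP ev] : mdeg mon == 1%N.
    have := mdeg_nested_cells mbP; rewrite eb mdegD (mdeg_nested_cells mbP').
    by rewrite -[j.+3]add1n => /addIn ->.
  exists v; last by rewrite ev mnm1E eqxx.
  have mb_v : (0 < mb v)%N by rewrite eb mnmDE ev mnm1E eqxx.
  have [r vr|c vc] := split_ordP v; first by rewrite vr curvex.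
  rewrite vc curvey; case: ifPn => // /negP[].
  rewrite -mem_enum -rows_r0; apply: (supp_nested_cells nest mbP); last by rewrite -vc.
  have : xsupport X mb by rewrite -xsupportE -xproj_wdeg -b_mb; apply/eqP.
  by move=> /forallP/(_ r0)/eqP ->; rewrite r0X.
(* All differentials vanish in this degree, so the homology is the span of the basis elements, which
   are then counted. *)
have part_cycles j : (spec_part _ (of_resolution L) j deg_X
    <= spec_cycles (@eval_generic k n m Y0) (of_resolution L) j deg_X)%MS.
  case: j => [|j] /=; first exact: submx_refl.
  by rewrite sub_capmx submx_refl; apply/sub_kermxP/bnd0.
rewrite bnd0 mxrank0 subn0; apply: leq_trans (mxrankS (part_cycles i)).
rewrite rank_spec_part (card_bdeg _ (eL i)) (eq_count (@xsupportE n m X)).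
rewrite (count_nested_cells urows i urs nest _ r0X); first by rewrite rows_r0 -cardE.
  by apply/subsetP => r; rewrite rsE.
move=> r rX; rewrite rows_r0 -!cardE; case: ifP => // _.
by rewrite subset_leq_card // subsetT.
Qed.

End LowerBound.

(** * The inequality between the Betti numbers *)

Theorem theorem1p1 (k : fieldType) (n m : nat) (G : bigraph n m)
    (X' : {set 'I_n}) (i : nat) :
  (xbetti (@edge_ideal k n m G) i X'
     >= xbetti (@edge_ideal k n m (degree_graph G)) i X')%N.
Proof.
(* Existence of resolutions makes each value chosen by [epsilon] the Tor dimension of some
   resolution; the bounds hold for every resolution. *)
have resolvable (H : bigraph n m) :
    exists d, exists F : graded_free_resolution (@xgrading n m) (@edge_ideal k n m H),
      tor_dim F i (\sum_(l in X') unit_deg l) = d.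
  have [cs hcs] := @resolved_monomial_ideal k _ _ (@xgrading n m)
    [seq edge_mon e.1 e.2 | e <- enum H].
  have [|F _] := resolved_iff (K' := @edge_ideal k n m H) _ hcs.
    by move=> p; apply: iff_sym; apply: edge_idealP => mon; exact: edge_mon_enumP.
  by exists (tor_dim F i (\sum_(l in X') unit_deg l)), F.
rewrite /xbetti /betti.
have [F <-] := epsilon_spec (inhabits 0%N) _ (resolvable (degree_graph G)).
have [F' <-] := epsilon_spec (inhabits 0%N) _ (resolvable G).
(* For empty [X'] the right-hand side vanishes, as every cell involves some [x_r]. *)
have [X0 | [r rX]] := set_0Vmem X'; first by rewrite tor_dim_degree_graph0.
case: (arg_minnP (xdegree G) rX) => r0 r0X r0_min.
apply: leq_trans (@tor_dim_degree_graph_le _ _ _ X' i G r0 F r0X r0_min) _.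
exact: (@nested_betti_le_tor_dim _ _ _ G X' r0 i r0X r0_min F').
Qed.
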